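(* Given $\varphi\in L^{p'}(\Omega,\nu)$ such that $$\mathcal{R}_{\gamma,\beta}^-<\int_\Omega\varphi\, d\nu<\mathcal{R}_{\gamma,\beta}^+,$$ problem $(GP_\varphi)$ has a solution.
   Context: **Metric random walk space.** $(X,d)$ is a Polish metric space with its Borel $\sigma$-algebra (all sets and measures refer to it). A random walk $m=(m_x)_{x\in X}$ on $X$ is a family of Borel probability measures $m_x$ on $X$ depending measurably on $x$ (for every Borel $A\subset X$, $x\mapsto m_x(A)$ is Borel) and each with finite first moment ($\int_X d(z,y)\,dm_x(y)<+\infty$ for some, hence any, $z\in X$). $[X,d,m]$ is called a metric random walk space. $\nu$ is a $\sigma$-finite measure on $X$ that is reversible with respect to $m$: for every Borel $C\subset X\times X$, $\int_X\int_X \chi_C(x,y)\,dm_x(y)\,d\nu(x)=\int_X\int_X \chi_C(x,y)\,dm_y(x)\,d\nu(y)$. The measure $\nu\otimes m_x$ on $X\times X$ is defined by $(\nu\otimes m_x)(C)=\int_X\int_X\chi_C(x,y)\,dm_x(y)\,d\nu(x)$. A measurable set $\Omega\subset X$ with $\nu(\Omega)>0$ is $m$-connected if $\int_A m_x(B)\,d\nu(x)>0$ for all measurable non-$\nu$-null $A,B\subset\Omega$ with $A\cup B=\Omega$. **The function $\mathbf a_p$.** $1<p<+\infty$, $p'=p/(p-1)$, and $\mathbf a_p:X\times X\times\mathbb R\to\mathbb R$ satisfies: $(x,y)\mapsto \mathbf a_p(x,y,r)$ is measurable for every $r\in\mathbb R$; for $\nu\otimes m_x$-a.e. $(x,y)$,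 $\mathbf a_p(x,y,\cdot)$ is continuous; and for $\nu\otimes m_x$-a.e. $(x,y)$ one has $\mathbf a_p(x,y,r)=-\mathbf a_p(y,x,-r)$ for every $r$, $(\mathbf a_p(x,y,r)-\mathbf a_p(x,y,s))(r-s)>0$ for every $r\ne s$, $|\mathbf a_p(x,y,r)|\le C_p(1+|r|^{p-1})$ and $\mathbf a_p(x,y,r)r\ge c_p|r|^p$ for every $r$, where $c_p,C_p>0$ are constants. **Domain and graphs.** $\Omega_1,\Omega_2\subset X$ are disjoint measurable non-$\nu$-null sets, $\Omega:=\Omega_1\cup\Omega_2$ is $m$-connected and $\nu(\Omega)<+\infty$. It is assumed that $\nu(\{x\in\Omega: m_x|_\Omega\perp\nu|_\Omega\})=0$, where $\perp$ denotes mutual singularity of the restrictions to $\Omega$. $\gamma,\beta$ are maximal monotone (multivalued) graphs in $\mathbb R\times\mathbb R$ with $0\in\gamma(0)\cap\beta(0)$ and $\mathcal R^-_{\gamma,\beta}<\mathcal R^+_{\gamma,\beta}$, where $\mathcal R^-_{\gamma,\beta}:=\nu(\Omega_1)\inf\mathrm{Ran}(\gamma)+\nu(\Omega_2)\inf\mathrm{Ran}(\beta)$ and $\mathcal R^+_{\gamma,\beta}:=\nu(\Omega_1)\sup\mathrm{Ran}(\gamma)+\nu(\Omega_2)\sup\mathrm{Ran}(\beta)$ (possibly infinite). **Poincaré type assumption.** For every $0<l\le\nu(\Omega)$ there is $\Lambda>0$ such that for every $u\in L^p(\Omega,\nu)$ and every measurable $Z\subset\Omega$ with $\nu(Z)\ge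 l$: $\|u\|_{L^p(\Omega,\nu)}\le\Lambda\big((\int_{\Omega\times\Omega}|u(y)-u(x)|^p\,dm_x(y)\,d\nu(x))^{1/p}+|\int_Z u\,d\nu|\big)$. **Problem $(GP_\varphi)$.** Given $\varphi\in L^1(\Omega,\nu)$, $(GP_\varphi)$ is the problem $\gamma(u(x))-\int_\Omega\mathbf a_p(x,y,u(y)-u(x))\,dm_x(y)\ni\varphi(x)$ for $x\in\Omega_1$, $\beta(u(x))-\int_\Omega\mathbf a_p(x,y,u(y)-u(x))\,dm_x(y)\ni\varphi(x)$ for $x\in\Omega_2$. A solution is a pair $[u,v]$ with $u\in L^p(\Omega,\nu)$, $v\in L^{p'}(\Omega,\nu)$ such that 1. $v(x)\in\gamma(u(x))$ for $\nu$-a.e. $x\in\Omega_1$; 2. $v(x)\in\beta(u(x))$ for $\nu$-a.e. $x\in\Omega_2$; 3. $(x,y)\mapsto\mathbf a_p(x,y,u(y)-u(x))$ belongs to $L^{p'}(\Omega\times\Omega,\nu\otimes m_x)$; 4. $v(x)-\int_\Omega\mathbf a_p(x,y,u(y)-u(x))\,dm_x(y)=\varphi(x)$ for ($\nu$-a.e.) $x\in\Omega$. *)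

(* Defs.v *)
From HB Require Import structures.
From mathcomp Require Import all_boot all_order all_algebra.
From mathcomp Require Import all_classical all_reals all_analysis.

Set Implicit Arguments.
Unset Strict Implicit.
Unset Printing Implicit Defensive.

Import Order.TTheory GRing.Theory Num.Theory.
Import numFieldNormedType.Exports.

Local Open Scope classical_set_scope.
Local Open Scope ring_scope.

(* Complete metric spaces that also carry a sigma-algebra, not yet tied to the
   topology: see [polish_borel]. *)
#[short(type="completeMetricMeasurableType")]
HB.structure Definition CompleteMetricMeasurable (d : measure_display)
    (R : numDomainType) :=
  { T of Metric R T & Complete T & Measurable d T }.

(* Completeness is part of the type of [X].  As [X] is separable, the product
   sigma-algebra on [X * X] is its Borel sigma-algebra. *)
Definition polish_borel (d : measure_display) (R : realType)
    (X : completeMetricMeasurableType d R) : Prop :=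
  (exists2 D : set X, countable D & dense D) /\
  (measurable : set (set X)) = <<s (open : set (set X)) >>.

Definition finite_first_moment (d : measure_display) (R : realType)
    (X : completeMetricMeasurableType d R) (m : R.-pker X ~> X) : Prop :=
  forall x : X, exists z : X, (\int[m x]_y (mdist z y)%:E < +oo)%E.

Section random_walk.
Context {d : measure_display} {R : realType} {X : measurableType d}.
Variables (nu : {measure set X -> \bar R}) (m : R.-pker X ~> X).

Definition reversible : Prop :=
  forall C : set (X * X), measurable C ->
    (\int[nu]_x \int[m x]_y (\1_C (x, y))%:E =
     \int[nu]_y \int[m y]_x (\1_C (x, y))%:E)%E.

(* The measure nu (x) m_x on X * X. *)
Definition walk_prod (C : set (X * X)) : \bar R :=
  (\int[nu]_x \int[m x]_y (\1_C (x, y))%:E)%E.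

Let walk_prod0 : walk_prod set0 = 0%E.
Proof.
by apply: integral0_eq => x _; apply: integral0_eq => y _; rewrite indic0.
Qed.

Let walk_prod_ge0 C : (0 <= walk_prod C)%E.
Proof.
by apply: integral_ge0 => x _; apply: integral_ge0 => y _; rewrite lee_fin.
Qed.

Lemma walk_prodE (C : set (X * X)) : measurable C ->
  walk_prod C = (\int[nu]_x m x (xsection C x))%E.
Proof.
move=> mC; apply: eq_integral => x _.
rewrite (_ : (fun y => (\1_C (x, y))%:E) = (fun y => (\1_(xsection C x) y)%:E)).
  by rewrite integral_indic ?setIT//; exact: measurable_xsection.
by apply/funext => y; rewrite !indicE mem_xsection.
Qed.

Let walk_prod_sigma_additive : semi_sigma_additive walk_prod.
Proof.
move=> F mF tF mUF.
rewrite walk_prodE//.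
rewrite (_ : (fun n => _) = (fun n =>
    \sum_(0 <= i < n) \int[nu]_x m x (xsection (F i) x))%E); last first.
  by apply/funext => n; apply: eq_bigr => i _; rewrite walk_prodE.
rewrite (_ : (\int[nu]_x _)%E =
    (\sum_(0 <= i <oo) \int[nu]_x m x (xsection (F i) x))%E).
  by apply: is_cvg_nneseries => n _ _; apply: integral_ge0.
rewrite -integral_nneseries//; last first.
  by move=> n; apply: measurable_fun_xsection_finite_kernel; rewrite inE.
apply: eq_integral => x _; rewrite xsection_bigcup.
apply/esym/cvg_lim => //; apply: measure_semi_sigma_additive.
- by move=> n; exact: measurable_xsection.
- exact: trivIset_xsection.
- by apply: bigcup_measurable => n _; exact: measurable_xsection.
Qed.

HB.instance Definition _ := isMeasure.Build _ _ _ walk_prod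
  walk_prod0 walk_prod_ge0 walk_prod_sigma_additive.

Definition m_connected (Om : set X) : Prop :=
  [/\ measurable Om, (0 < nu Om)%E &
    forall A B : set X, measurable A -> measurable B ->
      A `<=` Om -> B `<=` Om -> (0 < nu A)%E -> (0 < nu B)%E ->
      A `|` B = Om -> (0 < \int[nu]_(x in A) m x B)%E].

End random_walk.

Section measures.
Context {d : measure_display} {T : measurableType d} {R : realType}.

(* Mutual singularity of the restrictions of [mu1] and [mu2] to [Om]. *)
Definition singular_on (Om : set T) (mu1 mu2 : set T -> \bar R) : Prop :=
  exists A : set T,
    [/\ measurable A, A `<=` Om, mu1 A = 0%E & mu2 (Om `\` A) = 0%E].

(* [f] represents an element of L^p(D, mu).  Elements of L^p are classes, so
   [f] need only agree a.e. on [D] with a measurable function; this matters for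
   a_p(x, y, u(y) - u(x)), where a_p is continuous in its last argument for
   a.e. (x, y) only. *)
Definition in_Lp (mu : {measure set T -> \bar R}) (p : R) (D : set T)
    (f : T -> R) : Prop :=
  exists2 g : T -> R, g \_ D \in Lfun mu p%:E & f = g %[ae mu in D].

End measures.

Section graphs.
Context {R : realType}.
Implicit Types g : R -> set R.

Definition monotone_graph g : Prop :=
  forall r s v w : R, g r v -> g s w -> 0 <= (v - w) * (r - s).

Definition maximal_monotone g : Prop :=
  monotone_graph g /\
  forall h : R -> set R, monotone_graph h -> (forall r, g r `<=` h r) ->
    forall r, h r `<=` g r.

Definition Ran g : set R := \bigcup_r g r.

Definition inf_Ran g : \bar R := ereal_inf [set v%:E | v in Ran g].
Definition sup_Ran g : \bar R := ereal_sup [set v%:E | v in Ran g].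

End graphs.

Section problem.
Context {d : measure_display} {R : realType} {X : measurableType d}.
Variables (nu : {measure set X -> \bar R}) (m : R.-pker X ~> X).

(* The structural assumptions on a_p, with constants [c] and [C]. *)
Record leray_lions (p c C : R) (a : X -> X -> R -> R) : Prop := LerayLions {
  ll_meas : forall r : R, measurable_fun [set: X * X] (fun z => a z.1 z.2 r) ;
  ll_cont : {ae walk_prod nu m, forall z, continuous (a z.1 z.2)} ;
  ll_anti : {ae walk_prod nu m, forall z, forall r : R,
    a z.1 z.2 r = - a z.2 z.1 (- r)} ;
  ll_mono : {ae walk_prod nu m, forall z, forall r s : R, r != s ->
    0 < (a z.1 z.2 r - a z.1 z.2 s) * (r - s)} ;
  ll_growth : {ae walk_prod nu m, forall z, forall r : R,
    `|a z.1 z.2 r| <= C * (1 + `|r| `^ (p - 1))} ;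
  ll_coercive : {ae walk_prod nu m, forall z, forall r : R,
    c * `|r| `^ p <= a z.1 z.2 r * r} }.

Definition poincare (p : R) (Om : set X) : Prop :=
  forall l : R, 0 < l -> (l%:E <= nu Om)%E ->
  exists2 Lambda : R, 0 < Lambda &
    forall (u : X -> R) (Z : set X), in_Lp nu p Om u ->
      measurable Z -> Z `<=` Om -> (l%:E <= nu Z)%E ->
      ('N[nu]_(p%:E)[EFin \o (u \_ Om)] <= Lambda%:E *
        ((\int[nu]_(x in Om) \int[m x]_(y in Om) (`|u y - u x| `^ p)%:E) `^ p^-1
         + `|\int[nu]_(x in Z) (u x)%:E|))%E.

Variables (Om1 Om2 : set X) (gamma beta : R -> set R).

Definition R_minus : \bar R := (nu Om1 * inf_Ran gamma + nu Om2 * inf_Ran beta)%E.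
Definition R_plus : \bar R := (nu Om1 * sup_Ran gamma + nu Om2 * sup_Ran beta)%E.

(* [u, v] solves (GP_phi).  The equation is between extended reals, so that it
   forces its integral to be finite. *)
Record GP_solution (p : R) (a : X -> X -> R -> R) (phi u v : X -> R) : Prop :=
  GPSolution {
  gp_u : in_Lp nu p (Om1 `|` Om2) u ;
  gp_v : in_Lp nu (p / (p - 1)) (Om1 `|` Om2) v ;
  gp_gamma : {ae nu, forall x, Om1 x -> gamma (u x) (v x)} ;
  gp_beta : {ae nu, forall x, Om2 x -> beta (u x) (v x)} ;
  gp_flux : in_Lp (walk_prod nu m) (p / (p - 1))
    ((Om1 `|` Om2) `*` (Om1 `|` Om2)) (fun z => a z.1 z.2 (u z.2 - u z.1)) ;
  gp_eq : {ae nu, forall x, (Om1 `|` Om2) x ->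
    ((v x)%:E - \int[m x]_(y in Om1 `|` Om2) (a x y (u y - u x))%:E
     = (phi x)%:E)%E} }.

End problem.

(* Main.v *)
Require Import Defs.
From HB Require Import structures.
From mathcomp Require Import all_boot all_order all_algebra.
From mathcomp Require Import all_classical all_reals all_analysis.
From mathcomp Require Import measurable_realfun.
From mathcomp Require Import ring lra.

Set Implicit Arguments.
Unset Strict Implicit.
Unset Printing Implicit Defensive.

Import Order.TTheory GRing.Theory Num.Theory.
Import numFieldNormedType.Exports.

Local Open Scope classical_set_scope.
Local Open Scope ring_scope.

(** For fixed (x, y) the flux a_p(x, y, .) is a monotone function of one real
    variable, hence the derivative of a convex function A(x, y, .); likewise
    gamma and beta are contained in the subdifferentials of lower semicontinuous
    convex potentials, gathered into j(x, .). By the antisymmetry of the flux and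
    the reversibility of nu, the problem is the Euler-Lagrange equation of the
    convex functional

      J(u) = 1/2 iint A(x, y, u(y) - u(x)) dm_x(y) dnu(x) + int j(x, u) - int phi u

    on L^p, and a solution is obtained from a minimiser of J.

    Coercivity ([sublevel_coercive]). The Poincare inequality with Z the whole
    domain bounds u minus its mean by the double integral. The mean is bounded by
    the graphs: as int phi lies strictly between the two range constants, there
    are slopes in the ranges of gamma and beta whose weighted sum lies strictly
    above, respectively strictly below, int phi ([affine_minorant_above],
    [affine_minorant_below]). The affine minorants of j with these slopes grow
    faster than int phi u when the mean of u tends to either infinity.

    Existence ([sublevel_min]). The sublevel sets of J at levels decreasing to its
    infimum are convex and bounded in L^1, and such a family has a selection that
    converges almost everywhere ([nested_convex_ae_cvg]): points nearly
    minimising a strictly convex integral over these sets are close to each other,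
    because their midpoints stay in the sets. Fatou's lemma then gives the lower
    semicontinuity of J along the selection, once a small multiple of |u|^p is
    added to make the integrand bounded from below ([sublevel_closed]).

    The equation. Put f = phi + int a_p(x, y, u(y) - u(x)) dm_x(y), an element of
    L^q with q = p / (p - 1). Differentiating J at the minimiser u yields
    int f (w - u) <= int j(x, w) - int j(x, u) for all w ([euler_lagrange]).
    Comparing u with the function equal to r on a set E and to u elsewhere, for a
    point (r, s) of the graph at hand, gives (f - s)(u - r) >= 0 almost everywhere
    ([minimiser_monotone_test]). Countably many such points suffice to conclude
    that f belongs to gamma(u), respectively beta(u), by maximality
    ([maximal_monotone_test]), so that v = f solves the problem.

    Since a_p has its structural properties only almost everywhere, it is first
    replaced by a version that is monotone, continuous, antisymmetric and of the
    same growth everywhere, and coercive off a null set ([regular_flux_exists]). *)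

(** * Lower limits and Fatou's lemma *)

Lemma lte_EFin_between {R : realType} (x y : \bar R) :
  (x < y)%E -> exists2 a : R, (x < a%:E)%E & (a%:E < y)%E.
Proof.
case: x y => [r| |] [s| |] //; rewrite ?lte_fin => rs.
- by exists ((r + s) / 2); rewrite lte_fin; lra.
- by exists (r + 1); rewrite ?lte_fin ?ltry//; lra.
- by exists (s - 1); rewrite ?lte_fin ?ltNyr//; lra.
- by exists 0; rewrite ?ltNyr ?ltry.
Qed.

Lemma le_limn_einf {R : realType} (c : \bar R) (u : (\bar R)^nat) :
  (forall a : R, (a%:E < c)%E -> \forall n \near \oo, (a%:E <= u n)%E) ->
  (c <= limn_einf u)%E.
Proof.
move=> h; rewrite leNgt; apply/negP => /lte_EFin_between[a ua /h au].
suff : (a%:E <= limn_einf u)%E by rewrite leNgt ua.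
rewrite [limn_einf u](_ : _ = limf_einf u \oo)// limf_einfE.
apply: le_ereal_sup_tmp; exists (ereal_inf (u @` [set n | (a%:E <= u n)%E])).
  by exists [set n | (a%:E <= u n)%E].
by apply: le_ereal_inf_tmp => _ [n /= un <-].
Qed.

Lemma lt_limn_einf {R : realType} (a : R) (u : (\bar R)^nat) :
  (a%:E < limn_einf u)%E -> \forall n \near \oo, (a%:E <= u n)%E.
Proof.
rewrite [limn_einf u](_ : _ = limf_einf u \oo)// limf_einfE.
move=> /ereal_sup_gt[_ [V [k _ kV] <-] aV]; exists k => // n kn.
by apply: (le_trans (ltW aV)); apply: ereal_inf_lbound; exists n => //; exact: kV.
Qed.

(** This turns lower limits of two sequences into a bound for the sum of the
    limits, without assuming either of them finite. *)
Lemma ge0_adde_le_EFin {R : realType} (x y : \bar R) (s : R) :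
  (0 <= x)%E -> (0 <= y)%E ->
  (forall a b : R, (a%:E < x)%E -> (b%:E < y)%E -> a + b <= s) ->
  (x + y <= s%:E)%E.
Proof.
case: x y => [x| |] [y| |] //= x0 y0 h; rewrite ?lee_fin; do ?by [].
- apply/ler_addgt0Pr => e e0.
  have := h (x - e / 2) (y - e / 2); rewrite !lte_fin => /(_ _ _).
  by move=> H; have := H _ _; lra.
- have := h (x - 1) (s - x + 2); rewrite lte_fin ltry => /(_ _ isT) H.
  by exfalso; have := H _; lra.
- have := h (s - y + 2) (y - 1); rewrite lte_fin ltry => /(_ isT) H.
  by exfalso; have := H _; lra.
- by exfalso; have := h s (1 : R); rewrite !ltry => /(_ isT isT); lra.
Qed.

Lemma fatou_ae {d} {T : measurableType d} {R : realType}
    (mu : {measure set T -> \bar R}) (D : set T) (mD : measurable D)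
    (f_ : nat -> T -> \bar R) (f : T -> \bar R) :
  (forall n, measurable_fun D (f_ n)) -> measurable_fun D f ->
  (forall n x, D x -> (0 <= f_ n x)%E) -> (forall x, D x -> (0 <= f x)%E) ->
  {ae mu, forall x, D x -> (f x <= limn_einf (f_ ^~ x))%E} ->
  (\int[mu]_(x in D) f x <= limn_einf (fun n => \int[mu]_(x in D) f_ n x))%E.
Proof.
move=> mf_ mf f_0 f0 ff_; apply: le_trans (fatou mu mD mf_ f_0).
apply: ae_ge0_le_integral => //.
- move=> x Dx; apply: le_limn_einf => a /ltW a0; apply: nearW => n.
  exact: le_trans a0 (f_0 _ _ Dx).
- apply: measurableT_comp => //; apply: measurable_fun_limn_esup => n.
  exact: measurableT_comp.
Qed.

Lemma limn_einf_cvg_fin {R : realType} (u_ : R^nat) (u : R) :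
  u_ @ \oo --> u -> (u%:E <= limn_einf (fun n => (u_ n)%:E))%E.
Proof.
move=> uu; have /cvg_limn_einf_sup[-> _] // : (u_ n)%:E @[n --> \oo] --> u%:E.
by apply: cvg_EFin => //; exact: nearW.
Qed.

(** Lower limits are only superadditive in general, and in the extended reals
    the sum need not even make sense; a finite limit in the second summand
    avoids both difficulties. *)
Lemma limn_einf_addl {R : realType} (x : \bar R) (a_ : (\bar R)^nat)
    (u_ : R^nat) (u : R) :
  (0 <= x)%E -> (x <= limn_einf a_)%E -> u_ @ \oo --> u ->
  (x + u%:E <= limn_einf (fun n => a_ n + (u_ n)%:E))%E.
Proof.
move=> x0 xa uu; apply: le_limn_einf => s sxu.
have : ((s - u)%:E < x)%E by rewrite EFinB lteBlDr.
move=> /lte_EFin_between[r sr rx].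
have hr := lt_limn_einf (lt_le_trans rx xa).
have hu : \forall n \near \oo, s - r <= u_ n.
  by apply: (cvgr_ge _ uu); move: sr; rewrite lte_fin; lra.
near=> n; apply: (@le_trans _ _ (r%:E + (s - r)%:E)%E).
  by rewrite -EFinD lee_fin; lra.
by apply: leeD; [near: n|rewrite lee_fin; near: n].
Unshelve. all: by end_near. Qed.

(** * Convex potentials of monotone graphs *)

Section potential.
Context {R : realType}.
Implicit Types (g : R -> set R) (P Q : R * R) (l : seq (R * R)).

(** A lower bound for the increase, from P.1 to r, of any convex function whose
    subdifferential contains P and the points of l. *)
Fixpoint chain_sum P l (r : R) : R :=
  if l is Q :: l' then P.2 * (Q.1 - P.1) + chain_sum Q l' r
  else P.2 * (r - P.1).

Lemma chain_sumB P l r s :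
  chain_sum P l r - chain_sum P l s = (last P l).2 * (r - s).
Proof.
by elim: l P => [|Q l IH] P /=; [ring | rewrite -IH; ring].
Qed.

Lemma chain_sum_cat P l1 Q l2 r :
  chain_sum P (l1 ++ Q :: l2) r = chain_sum P l1 Q.1 + chain_sum Q l2 r.
Proof. by elim: l1 P => [//|Q1 l1 IH] P /=; rewrite IH addrA. Qed.

Definition graph_list g l : Prop := forall P, P \in l -> g P.1 P.2.

Lemma graph_list_cons g P l :
  graph_list g (P :: l) <-> g P.1 P.2 /\ graph_list g l.
Proof.
split=> [h|[hP hl] Q]; last by rewrite inE => /predU1P[->//|/hl].
by split=> [|Q Ql]; apply: h; rewrite inE ?eqxx// Ql orbT.
Qed.

Lemma graph_list_cat g l1 l2 :
  graph_list g (l1 ++ l2) <-> graph_list g l1 /\ graph_list g l2.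
Proof.
split=> [h|[h1 h2] P]; last by rewrite mem_cat => /orP[/h1|/h2].
by split=> P Pl; apply: h; rewrite mem_cat Pl ?orbT.
Qed.

Lemma max_sum_mem P l :
  exists2 Q, Q \in P :: l & forall Q', Q' \in P :: l -> Q'.1 + Q'.2 <= Q.1 + Q.2.
Proof.
elim: l P => [|P' l IH] P.
  by exists P => [|Q']; rewrite !inE// => /eqP->.
have [Q Ql hQ] := IH P'.
have [h|h] := leP (P.1 + P.2) (Q.1 + Q.2).
  by exists Q => [|Q']; rewrite in_cons ?Ql ?orbT// => /predU1P[->//|/hQ].
exists P => [|Q']; first exact: mem_head.
by rewrite in_cons => /predU1P[->//|/hQ/le_trans]; apply; exact: ltW.
Qed.

(** For a monotone graph one coordinate cannot decrease strictly while the other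
    increases strictly, so comparing the sums compares both coordinates. *)
Lemma monotone_sum_le g P Q : monotone_graph g ->
  g P.1 P.2 -> g Q.1 Q.2 -> P.1 + P.2 <= Q.1 + Q.2 ->
  P.1 <= Q.1 /\ P.2 <= Q.2.
Proof.
move=> mg gP gQ PQ; have := mg _ _ _ _ gP gQ => h.
by split; rewrite leNgt; apply/negP => lt; nra.
Qed.

(** Cyclic monotonicity, by induction on the length of the cycle. Rotating the
    cycle does not change its sum, so it may start at a point with the largest
    sum of coordinates; both coordinates are then maximal, and removing this
    point can only increase the sum. *)
Lemma chain_sum_cycle_le0 g P l : monotone_graph g ->
  graph_list g (P :: l) -> chain_sum P l P.1 <= 0.
Proof.
move=> mg; have [n] := ubnP (size l); elim: n P l => // n IH P l /ltnSE ln gl.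
have step P' l' : size l' = size l -> graph_list g (P' :: l') ->
    (forall Q, Q \in l' -> Q.1 + Q.2 <= P'.1 + P'.2) ->
    chain_sum P' l' P'.1 <= 0.
  case: l' => [|Q l'] /= sl gl' maxP; first by rewrite subrr mulr0.
  have /IH/(_ _) IHQ : (size l' < n)%N by rewrite (leq_trans _ ln)// -sl.
  move/graph_list_cons : gl' => [gP' gl'].
  have {IHQ} := IHQ _ gl'; rewrite -subr_ge0 sub0r => IHQ.
  have gQ : g Q.1 Q.2 by apply: gl'; exact: mem_head.
  have [h1 _] := monotone_sum_le mg gQ gP' (maxP _ (mem_head _ _)).
  have lQ : last Q l' \in Q :: l' by exact: mem_last.
  have [_ h2] := monotone_sum_le mg (gl' _ lQ) gP' (maxP _ lQ).
  have := chain_sumB Q l' P'.1 Q.1; nra.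
have [Q + maxQ] := max_sum_mem P l; rewrite in_cons => /predU1P[QP|Ql].
  by apply: step => // Q' Q'l; rewrite -QP; apply: maxQ; rewrite in_cons Q'l orbT.
(* Rotation: the chain P, l1, Q, l2 back to P has the same sum as the chain Q,
   l2, P, l1 back to Q. *)
case/splitPr: Ql ln gl step maxQ => l1 l2 ln gl step maxQ.
rewrite chain_sum_cat addrC -chain_sum_cat; apply: step.
- by rewrite !size_cat/= addnC addSnnS.
- move=> Q'; rewrite in_cons mem_cat in_cons => hQ'; apply: gl.
  by rewrite in_cons mem_cat in_cons; move: hQ'; case: (Q' == Q);
    case: (Q' == P); case: (Q' \in l1); case: (Q' \in l2); rewrite ?orbT.
- move=> Q'; rewrite mem_cat in_cons => hQ'; apply: maxQ.
  by rewrite in_cons mem_cat in_cons; move: hQ';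
    case: (Q' == P); case: (Q' \in l1); case: (Q' \in l2); rewrite ?orbT.
Qed.

(** Rockafellar's antiderivative of the graph, based at the point (0, 0). As a
    supremum of affine functions it is convex and lower semicontinuous, and it
    may take the value +oo where the graph is empty. *)
Definition potential g (r : R) : \bar R :=
  ereal_sup [set (chain_sum (0, 0) l r)%:E | l in graph_list g].

Section potential_theory.
Variable g : R -> set R.
Hypotheses (mg : monotone_graph g) (g00 : g 0 0).

Lemma potential_ge0 r : (0 <= potential g r)%E.
Proof.
by apply: ereal_sup_ubound; exists [::] => [P|]; rewrite /= ?mul0r.
Qed.

Lemma potential0 : potential g 0 = 0%E.
Proof.
apply/eqP; rewrite eq_le potential_ge0 andbT.
apply: ge_ereal_sup => _ [l gl <-]; rewrite lee_fin.
apply: (@chain_sum_cycle_le0 g (0, 0)) => //.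
by apply/graph_list_cons; split.
Qed.

(** Any chain ending before r can be prolonged by (r, v). *)
Lemma potential_subgradient r v s : g r v ->
  (potential g r + (v * (s - r))%:E <= potential g s)%E.
Proof.
move=> grv; rewrite -leeBrDr//; apply: ge_ereal_sup => _ [l gl <-].
rewrite leeBrDr// -EFinD; apply: ereal_sup_ubound.
exists (rcons l (r, v)); last by rewrite -cats1 chain_sum_cat.
by rewrite -cats1; apply/graph_list_cat; split => //; apply/graph_list_cons.
Qed.

(** The subgradient inequality at r, evaluated at 0, bounds the potential at r
    from above. *)
Lemma potential_fin r v : g r v -> potential g r \is a fin_num.
Proof.
move=> grv; rewrite ge0_fin_numE ?potential_ge0//.
have := potential_subgradient 0 grv; rewrite potential0 -leeBrDr// sub0e.
by move=> /le_lt_trans; apply; rewrite -EFinN ltry.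
Qed.

Lemma potential_convex t r s : 0 <= t <= 1 ->
  (potential g (t * r + (1 - t) * s)
   <= t%:E * potential g r + (1 - t)%:E * potential g s)%E.
Proof.
move=> /andP[t0 t1]; apply: ge_ereal_sup => _ [l gl <-].
have -> : chain_sum (0, 0) l (t * r + (1 - t) * s) =
    t * chain_sum (0, 0) l r + (1 - t) * chain_sum (0, 0) l s.
  have := chain_sumB (0, 0) l r (t * r + (1 - t) * s).
  have := chain_sumB (0, 0) l s (t * r + (1 - t) * s).
  move=> /(congr1 (fun x => (1 - t) * x)) h1 /(congr1 (fun x => t * x)) h2.
  by apply/eqP; rewrite -subr_eq0; apply/eqP; nra.
rewrite EFinD !EFinM; apply: leeD; apply: lee_wpmul2l; rewrite ?lee_fin//.
- by apply: ereal_sup_ubound; exists l.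
- by rewrite subr_ge0.
- by apply: ereal_sup_ubound; exists l.
Qed.

Lemma chain_sum_continuous P l : continuous (chain_sum P l).
Proof.
move=> r; rewrite (_ : chain_sum P l =
    (fun s => (last P l).2 * (s - r)) + cst (chain_sum P l r)); last first.
  by apply/funext => s; rewrite !fctE -chain_sumB subrK.
apply: continuousD; last exact: cst_continuous.
apply: (@continuousM _ _ (cst _) (id - cst r)); first exact: cst_continuous.
by apply: continuousB; [exact: cvg_id|exact: cst_continuous].
Qed.

Lemma potential_lsc : lower_semicontinuous (potential g).
Proof.
move=> r a /ereal_sup_gt[_ [l gl <-]]; rewrite lte_fin => al.
have /cvgr_gt/(_ _ al) := @chain_sum_continuous (0, 0) l r.
exists [set s | a < chain_sum (0, 0) l s] => //.
move=> s /= as_; apply: (@lt_le_trans _ _ (chain_sum (0, 0) l s)%:E).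
  by rewrite lte_fin.
by apply: ereal_sup_ubound; exists l.
Qed.

Lemma measurable_potential : measurable_fun [set: R] (potential g).
Proof. by apply: lower_semicontinuous_measurable; exact: potential_lsc. Qed.

Lemma potential_le_liminf (u_ : R^nat) (u : R) : u_ @ \oo --> u ->
  (potential g u <= limn_einf (fun n => potential g (u_ n)))%E.
Proof.
move=> u_u; apply: le_limn_einf => a /potential_lsc[V Vu hV].
near=> n; apply/ltW/hV; near: n; exact: (u_u _ Vu).
Unshelve. all: by end_near. Qed.

End potential_theory.
End potential.

(** * Integrals of real-valued functions *)

Section real_integrals.
Context {d} {T : measurableType d} {R : realType}.
Variables (mu : {measure set T -> \bar R}) (D : set T) (mD : measurable D).
Implicit Types f g : T -> R.

Lemma ge0_integralD_EFin f g :
  measurable_fun D f -> measurable_fun D g ->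
  (forall x, D x -> 0 <= f x) -> (forall x, D x -> 0 <= g x) ->
  (\int[mu]_(x in D) (f x + g x)%:E =
   \int[mu]_(x in D) (f x)%:E + \int[mu]_(x in D) (g x)%:E)%E.
Proof.
move=> mf mg f0 g0; under eq_integral do rewrite EFinD.
by rewrite ge0_integralD//; by [move=> x Dx; rewrite lee_fin; auto|
  exact/measurable_EFinP].
Qed.

Lemma ge0_integralZl_cst f c : measurable_fun D f ->
  (forall x, D x -> 0 <= f x) -> 0 <= c ->
  (\int[mu]_(x in D) (c * f x)%:E = c%:E * \int[mu]_(x in D) (f x)%:E)%E.
Proof.
move=> mf f0 c0; under eq_integral do rewrite EFinM.
by rewrite ge0_integralZl//; by [move=> x Dx; rewrite lee_fin; auto|
  exact/measurable_EFinP].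
Qed.

Lemma ge0_le_integral_EFin f g :
  measurable_fun D f -> measurable_fun D g ->
  (forall x, D x -> 0 <= f x) -> (forall x, D x -> f x <= g x) ->
  (\int[mu]_(x in D) (f x)%:E <= \int[mu]_(x in D) (g x)%:E)%E.
Proof.
move=> mf mg f0 fg; apply: ge0_le_integral => //; by [exact/measurable_EFinP|
  move=> x Dx; rewrite lee_fin; auto].
Qed.

Lemma integral_EFin_ge0 f : (forall x, D x -> 0 <= f x) ->
  (0 <= \int[mu]_(x in D) (f x)%:E)%E.
Proof. by move=> f0; apply: integral_ge0 => x Dx; rewrite lee_fin f0. Qed.

End real_integrals.

(** * A strictly convex function of linear growth *)

Section strictly_convex_weight.
Context {R : realType}.
Implicit Types a b t : R.

Let sqr_abs t : `|t| ^+ 2 = t ^+ 2.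
Proof. by rewrite real_normK ?num_real. Qed.

(** The Japanese bracket: strictly convex, yet of linear growth, so that it is
    integrable as soon as its argument is. *)
Definition jap t := Num.sqrt (1 + t ^+ 2).
(** The derivative of [jap], a homeomorphism of the line onto ]-1, 1[. *)
Definition tau t := t / jap t.

Lemma jap_sqr t : jap t ^+ 2 = 1 + t ^+ 2.
Proof. by rewrite sqr_sqrtr// addr_ge0// sqr_ge0. Qed.

Lemma jap_ge1 t : 1 <= jap t.
Proof. by rewrite -sqrtr1 ler_wsqrtr// lerDl sqr_ge0. Qed.

Lemma jap_gt0 t : 0 < jap t. Proof. exact: lt_le_trans (jap_ge1 t). Qed.

Lemma jap_ge0 t : 0 <= jap t. Proof. exact/ltW/jap_gt0. Qed.

Lemma jap_le t : jap t <= 1 + `|t|.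
Proof.
have h := jap_sqr t; have h1 := jap_ge1 t; have t0 : 0 <= `|t| by [].
have := sqr_abs t; set s := `|t| in t0 *.
by move=> ss; rewrite leNgt; apply/negP => lt; nra.
Qed.

Lemma tau_bound t L : `|t| <= L -> `|tau t| <= tau L.
Proof.
move=> tL; have L0 : 0 <= L by exact: le_trans tL.
rewrite /tau normrM normfV (gtr0_norm (jap_gt0 t)).
have hL := jap_sqr L; have ht := jap_sqr t.
have j1 := jap_gt0 t; have j2 := jap_gt0 L.
rewrite ler_pdivrMr// mulrAC ler_pdivlMr//.
rewrite -(@ler_pXn2r _ 2)// ?nnegrE; [|apply: mulr_ge0 => //; exact: ltW..].
rewrite !exprMn hL ht sqr_abs.
have : t ^+ 2 <= L ^+ 2 by rewrite -sqr_abs ler_pXn2r// nnegrE.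
by nra.
Qed.

Lemma tau_lt1 t : tau t < 1.
Proof.
rewrite /tau ltr_pdivrMr ?jap_gt0// mul1r.
have h := jap_sqr t; have h1 := jap_gt0 t.
by rewrite ltNge; apply/negP => le; nra.
Qed.

Lemma tauK t : tau t / Num.sqrt (1 - tau t ^+ 2) = t.
Proof.
have j0 := jap_gt0 t.
have -> : 1 - tau t ^+ 2 = (jap t)^-1 ^+ 2.
  rewrite /tau exprMn -(mulfV (lt0r_neq0 (exprn_gt0 2 j0))) -exprVn -mulrBl.
  by rewrite jap_sqr addrK mul1r.
by rewrite sqrtr_sqr ger0_norm ?invr_ge0 ?(ltW j0)// invrK /tau divfK ?gt_eqF.
Qed.

(** The bracket of t is the length of the vector (1, t), and equality in the
    triangle inequality for (1, a) and (1, b) only holds when they have the same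
    direction; [tau] measures the direction. The estimate is quadratic in the
    difference of directions and uniform in a and b, which no modulus in terms
    of a - b could be. *)
Lemma jap_convex_defect a b :
  (tau a - tau b) ^+ 2 / 8 + jap ((a + b) / 2) <= jap a / 2 + jap b / 2.
Proof.
have hA := jap_sqr a; have hB := jap_sqr b; have hM := jap_sqr ((a + b) / 2).
have A1 := jap_ge1 a; have B1 := jap_ge1 b; have M0 := jap_gt0 ((a + b) / 2).
rewrite /tau; set A := jap a in hA A1 *; set B := jap b in hB B1 *.
set M := jap _ in hM M0 *.
have A0 : 0 < A by lra. have B0 : 0 < B by lra.
have P0 : 0 < A * B by exact: mulr_gt0.
have qP : 1 + a * b <= A * B.
  have : (1 + a * b) ^+ 2 <= (A * B) ^+ 2.
    by rewrite exprMn hA hB; have := sqr_ge0 (a - b); nra.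
  by move=> h; rewrite leNgt; apply/negP => lt; nra.
have MAB : 2 * M <= A + B.
  by rewrite leNgt; apply/negP => lt; nra.
have key : (A * B - (1 + a * b)) <= (A + B) * (A + B - 2 * M).
  have -> : A * B - (1 + a * b) = (A + B - 2 * M) * (A + B + 2 * M) / 2.
    have -> : (A + B - 2 * M) * (A + B + 2 * M) = A ^+ 2 + B ^+ 2 + 2 * A * B - 4 * M ^+ 2 by ring.
    by rewrite hA hB hM; field.
  by nra.
have tAB : (a / A - b / B) ^+ 2 <= 2 * (A * B - (1 + a * b)) / (A * B).
  have -> : (a / A - b / B) ^+ 2 =
      a ^+ 2 / A ^+ 2 + b ^+ 2 / B ^+ 2 - 2 * (a * b) / (A * B).
    by field; rewrite !gt_eqF.
  have -> : a ^+ 2 / A ^+ 2 = 1 - A^-1 ^+ 2.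
    by rewrite (_ : a ^+ 2 = A ^+ 2 - 1); [field; rewrite gt_eqF|rewrite hA; ring].
  have -> : b ^+ 2 / B ^+ 2 = 1 - B^-1 ^+ 2.
    by rewrite (_ : b ^+ 2 = B ^+ 2 - 1); [field; rewrite gt_eqF|rewrite hB; ring].
  have -> : 2 * (A * B - (1 + a * b)) / (A * B) =
      2 - 2 * (A^-1 * B^-1) - 2 * (a * b) / (A * B) by field; rewrite !gt_eqF.
  by have := sqr_ge0 (A^-1 - B^-1); nra.
suff : (a / A - b / B) ^+ 2 <= 4 * (A + B - 2 * M) by lra.
apply: (le_trans tAB); rewrite ler_pdivrMr//.
have : A + B <= 2 * (A * B) by nra.
by nra.
Qed.

Lemma continuous_jap : continuous jap.
Proof.
move=> t; apply: (@continuous_comp _ _ _ (fun t => 1 + t ^+ 2) Num.sqrt).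
  by apply: (@continuousD R R R (cst 1) (fun t => t ^+ 2));
    [exact: cst_continuous|exact: exprn_continuous].
exact: sqrt_continuous.
Qed.

Lemma continuous_tau : continuous tau.
Proof.
move=> t; apply: (@continuousM R R id (fun t => (jap t)^-1)); first exact: cvg_id.
by apply: (@continuousV R R jap); [rewrite gt_eqF ?jap_gt0|exact: continuous_jap].
Qed.

(** A limit of [tau] could be 1 or -1, that is, the sequence could tend to
    infinity; being infinitely often in a bounded interval rules this out. *)
Lemma cvg_of_tau (u_ : R^nat) (L : R) : cvgn (tau \o u_) ->
  (forall N, exists2 n, (N <= n)%N & `|u_ n| <= L) ->
  exists l : R, u_ @ \oo --> l.
Proof.
move=> /cvg_ex[/= th uth] often.
have th1 : `|th| <= tau L.
  rewrite leNgt; apply/negP => lt.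
  have [N _ hN] := cvgr_gt _ (cvg_norm uth) _ lt.
  have [n Nn un] := often N.
  by have := hN n Nn; rewrite /= ltNge tau_bound.
have h0 : 0 < 1 - th ^+ 2.
  have := le_lt_trans th1 (tau_lt1 L); rewrite subr_gt0 -sqr_abs => lt.
  by rewrite expr_lt1.
exists (th / Num.sqrt (1 - th ^+ 2)).
have -> : u_ = (fun t => t / Num.sqrt (1 - t ^+ 2)) \o (tau \o u_).
  by apply/funext => n /=; rewrite tauK.
apply: continuous_cvg => //.
apply: (@continuousM R R id (fun t => (Num.sqrt (1 - t ^+ 2))^-1));
  first exact: cvg_id.
apply: (@continuousV R R (fun t => Num.sqrt (1 - t ^+ 2))).
  by rewrite gt_eqF// sqrtr_gt0.
apply: (@continuous_comp _ _ _ (fun t => 1 - t ^+ 2) Num.sqrt);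
  last exact: sqrt_continuous.
by apply: (@continuousB R R R (cst 1) (fun t => t ^+ 2));
  [exact: cst_continuous|exact: exprn_continuous].
Qed.

End strictly_convex_weight.

(** * Almost everywhere convergent selections from nested convex sets *)

Section nested_convex.
Context {d} {T : measurableType d} {R : realType}.
Variables (mu : {measure set T -> \bar R}) (D : set T) (mD : measurable D).
Hypothesis muD : (mu D < +oo)%E.
Variables (K : nat -> set (T -> R)) (M : R).
Hypothesis K_neq0 : forall n, K n !=set0.
Hypothesis K_decr : forall m n, (m <= n)%N -> K n `<=` K m.
Hypothesis K_meas : forall u, K 0%N u -> measurable_fun [set: T] u.
Hypothesis K_mid : forall n u v, K n u -> K n v ->
  K n (fun x => (u x + v x) / 2).
Hypothesis K_bnd : forall u, K 0%N u -> (\int[mu]_(x in D) `|u x|%:E <= M%:E)%E.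

Let S (u : T -> R) : \bar R := (\int[mu]_(x in D) (jap (u x))%:E)%E.

Let K0 n u : K n u -> K 0%N u. Proof. exact: K_decr. Qed.

Let measurable_fun_jap (u : T -> R) : measurable_fun [set: T] u ->
  measurable_fun [set: T] (fun x => jap (u x)).
Proof.
move=> mu'; apply: measurableT_comp => //.
by apply: continuous_measurable_fun; exact: continuous_jap.
Qed.

Let measurable_fun_tau (u : T -> R) : measurable_fun [set: T] u ->
  measurable_fun [set: T] (fun x => tau (u x)).
Proof.
move=> mu'; apply: measurableT_comp => //.
by apply: continuous_measurable_fun; exact: continuous_tau.
Qed.

Let muDE : mu D = (fine (mu D))%:E. Proof. by rewrite fineK// ge0_fin_numE. Qed.

Let S_le u : K 0%N u -> (S u <= (fine (mu D) + M)%:E)%E.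
Proof.
move=> Ku; have mu' := K_meas Ku.
apply: (@le_trans _ _ (\int[mu]_(x in D) (1 + `|u x|)%:E)%E).
  apply: ge0_le_integral_EFin => //.
  - exact/measurable_funTS/measurable_fun_jap.
  - by apply: measurable_funTS; apply: measurable_funD => //; exact: measurableT_comp.
  - by move=> x _; exact/ltW/jap_gt0.
  - by move=> x _; exact: jap_le.
rewrite ge0_integralD_EFin//; last by apply/measurable_funTS/measurableT_comp.
by rewrite integral_cst// mul1e EFinD -muDE leeD2l// K_bnd.
Qed.

Let S_fin n u : K n u -> S u = (fine (S u))%:E.
Proof.
move=> /K0 Ku; rewrite fineK// ge0_fin_numE.
  by apply: (le_lt_trans (S_le Ku)); rewrite ltry.
by apply: integral_EFin_ge0 => x _; exact/ltW/jap_gt0.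
Qed.

(** The infima of S over the sets K n increase with n to a finite limit s. Far
    enough in the sequence, every element of K n is nearly above s, and some
    element is nearly at s. *)
Let near_minimal (e : nat -> R) : (forall n, 0 < e n) ->
  exists s : R, forall k, exists uN : (T -> R) * nat,
    [/\ (k <= uN.2)%N, K uN.2 uN.1, fine (S uN.1) < s + e k &
        forall v, K uN.2 v -> s - e k < fine (S v)].
Proof.
move=> e0; pose F n := [set fine (S u) | u in K n].
have F0 n : F n !=set0 by have [u Ku] := K_neq0 n; exists (fine (S u)), u.
have lbF n : lbound (F n) 0.
  move=> _ [u Ku <-]; apply: fine_ge0.
  by apply: integral_EFin_ge0 => x _; exact/ltW/jap_gt0.
have hlF n : has_lbound (F n) by exists 0.
pose i n := inf (F n).
have i_le n u : K n u -> i n <= fine (S u).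
  by move=> Ku; apply: ge_inf => //; exists u.
have i_nd m n : (m <= n)%N -> i m <= i n.
  move=> mn; apply: lb_le_inf => // _ [u Ku <-]; apply: i_le.
  exact: K_decr Ku.
have ubi : has_sup (range i).
  split; first by exists (i 0%N), 0%N.
  exists (fine (mu D) + M) => _ [n _ <-].
  have [u Ku] := K_neq0 n; apply: (le_trans (i_le _ _ Ku)).
  by rewrite -lee_fin -(S_fin Ku) S_le//; exact: K0 Ku.
exists (sup (range i)) => k.
have [_ [n _ <-] hn] := sup_adherent (e0 k) ubi.
pose N := maxn n k; have hN := i_nd n N (leq_maxl _ _).
have [_ [u Ku <-] hu] := inf_adherent (e0 k) (conj (F0 N) (hlF N)).
exists (u, N); split => //=; first exact: leq_maxr.
  apply: (lt_le_trans hu); rewrite lerD2r; apply: ub_le_sup; first by case: ubi.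
  by exists N.
by move=> v Kv; apply: (lt_le_trans hn); apply: (le_trans hN); exact: i_le.
Qed.

(** Since the midpoint of u and v is again in K n, it cannot lie much below s;
    by [jap_convex_defect] this makes tau u and tau v close in L^2. *)
Let tau_defect n u v (s e : R) : K n u -> K n v ->
  fine (S u) <= s + e -> fine (S v) <= s + e ->
  (forall w, K n w -> s - e <= fine (S w)) ->
  (\int[mu]_(x in D) ((tau (u x) - tau (v x)) ^+ 2)%:E <= (16 * e)%:E)%E.
Proof.
move=> Ku Kv Su Sv low; set w := fun x => (u x + v x) / 2.
have Kw : K n w by exact: K_mid.
have mU := K_meas (K0 Ku); have mV := K_meas (K0 Kv); have mW := K_meas (K0 Kw).
have mT : measurable_fun D (fun x => (tau (u x) - tau (v x)) ^+ 2).
  apply: measurable_funTS; apply: measurable_funX; apply: measurable_funB;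
    exact: measurable_fun_tau.
set I := (\int[mu]_(x in D) _)%E.
have j0 (z : T -> R) x : D x -> 0 <= jap (z x) by move=> _; exact: jap_ge0.
have mj (z : T -> R) : measurable_fun [set: T] z ->
    measurable_fun D (fun x => jap (z x)).
  by move=> mz; apply: measurable_funTS; exact: measurable_fun_jap.
have mhj (z : T -> R) : measurable_fun [set: T] z ->
    measurable_fun D (fun x => 2^-1 * jap (z x)).
  by move=> mz; apply: measurable_funM => //; exact: mj.
have hj0 (z : T -> R) x : D x -> 0 <= 2^-1 * jap (z x).
  by move=> Dx; rewrite mulr_ge0// ?invr_ge0// j0.
have t0 x : D x -> 0 <= 8^-1 * (tau (u x) - tau (v x)) ^+ 2.
  by move=> _; rewrite mulr_ge0// sqr_ge0.
have mT8 : measurable_fun D (fun x => 8^-1 * (tau (u x) - tau (v x)) ^+ 2).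
  exact: measurable_funM.
have h : (8^-1%:E * I + S w <= 2^-1%:E * S u + 2^-1%:E * S v)%E.
  rewrite -ge0_integralZl_cst//; last by move=> x _; exact: sqr_ge0.
  rewrite -ge0_integralD_EFin//; [|exact: mj|exact: j0].
  rewrite -!ge0_integralZl_cst//; [|exact: mj|exact: j0|exact: mj|exact: j0].
  rewrite -ge0_integralD_EFin//; [|exact: mhj|exact: mhj|exact: hj0|exact: hj0].
  apply: ge0_le_integral_EFin => //.
  - by apply: measurable_funD => //; exact: mj.
  - by apply: measurable_funD; exact: mhj.
  - by move=> x Dx; rewrite addr_ge0 ?t0 ?j0.
  - by move=> x _; have := jap_convex_defect (u x) (v x); rewrite /w; lra.
have I0 : (0 <= I)%E by apply: integral_EFin_ge0 => x _; exact: sqr_ge0.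
move: h; rewrite (S_fin Ku) (S_fin Kv) (S_fin Kw) -!EFinM -EFinD => h.
have If : I \is a fin_num.
  rewrite ge0_fin_numE//; rewrite ltNge leye_eq; apply/eqP => Iy.
  by move: h; rewrite Iy mulry gtr0_sg// mul1e.
move: h (low _ Kw); rewrite -(fineK If) -EFinM -EFinD !lee_fin; lra.
Qed.

(** Nearly minimal elements u_n for the strictly convex functional S make the
    differences of consecutive tau u_n summable in L^1, so tau u_n converges
    almost everywhere. The bound in L^1 and Fatou keep the lower limit of |u_n|
    finite, so that the limit of tau u_n is neither 1 nor -1. *)
Lemma nested_convex_ae_cvg : exists (u_ : nat -> T -> R) (u : T -> R),
  [/\ forall n, K n (u_ n), measurable_fun [set: T] u &
      {ae mu, forall x, D x -> u_ ^~ x @ \oo --> u x}].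
Proof.
(* The distances in L^2 are of order 2^-n, hence summable. *)
pose e n : R := (4 ^+ n)^-1.
have e0 n : 0 < e n by rewrite invr_gt0 exprn_gt0.
have e_dec n : e n.+1 <= e n.
  by rewrite lef_pV2 ?posrE ?exprn_gt0// exprS ler_peMl ?exprn_ge0 ?ler1n.
have [s /choice[uN huN]] := near_minimal e0.
pose u_ n := (uN n).1; pose N n := (uN n).2.
have Ku n : K n (u_ n) by case: (huN n) => ? ? _ _; exact: K_decr (_ : K (N n) _).
have mu_ n : measurable_fun [set: T] (u_ n) by exact/K_meas/K0/Ku.
pose Dl n x := `|tau (u_ n.+1 x) - tau (u_ n x)|.
have mDl n : measurable_fun [set: T] (Dl n).
  apply: measurableT_comp => //; apply: measurable_funB; exact: measurable_fun_tau.
have Dl2 n : (\int[mu]_(x in D) ((Dl n x) ^+ 2)%:E <= (16 * e n)%:E)%E.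
  have [_ K1 S1 low1] := huN n; have [_ K2 S2 low2] := huN n.+1.
  have -> : (\int[mu]_(x in D) (Dl n x ^+ 2)%:E =
    \int[mu]_(x in D) ((tau (u_ n.+1 x) - tau (u_ n x)) ^+ 2)%:E)%E.
    by apply: eq_integral => x _; rewrite /Dl real_normK ?num_real.
  apply: (@tau_defect (minn (N n) (N n.+1)) _ _ s).
  - exact: K_decr (geq_minr _ _) _ K2.
  - exact: K_decr (geq_minl _ _) _ K1.
  - by apply: (le_trans (ltW S2)); rewrite lerD2l.
  - exact: ltW.
  - move=> w; case: (leqP (N n) (N n.+1)) => _ Kw; first exact/ltW/low1.
    by apply: le_trans (ltW (low2 _ Kw)); rewrite lerD2l lerN2.
have Dl1 n : (\int[mu]_(x in D) (Dl n x)%:E <=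
    ((fine (mu D) + 16) / 2 ^+ n)%:E)%E.
  apply: (@le_trans _ _
    (\int[mu]_(x in D) ((2 ^+ n)^-1 + 2 ^+ n * (Dl n x) ^+ 2)%:E)%E).
    apply: ge0_le_integral_EFin => //; first exact: measurable_funTS.
    - apply: measurable_funTS; apply: measurable_funD => //.
      by apply: measurable_funM => //; exact: measurable_funX.
    - by move=> x _; exact: normr_ge0.
    move=> x _; have D0 : 0 <= Dl n x by exact: normr_ge0.
    have t0 : 0 < (2 ^+ n : R) by exact: exprn_gt0.
    set a := 2 ^+ n in t0 *; set b := Dl n x in D0 *.
    (* The inequality b <= 1/a + a b^2 passes from L^2 to L^1; the weight a =
       2^n balances the two terms. *)
    have -> : a^-1 + a * b ^+ 2 = a * ((a^-1 - b) ^+ 2 + a^-1 * b) + b.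
      by field; rewrite gt_eqF.
    by rewrite lerDr mulr_ge0 ?(ltW t0)// addr_ge0 ?sqr_ge0// mulr_ge0// invr_ge0 ltW.
  have t0 : 0 < (2 ^+ n : R) by exact: exprn_gt0.
  have D2 x : D x -> 0 <= Dl n x ^+ 2 by move=> _; exact: sqr_ge0.
  have mD2 : measurable_fun D (fun x => Dl n x ^+ 2).
    by apply: measurable_funTS; exact: measurable_funX.
  rewrite ge0_integralD_EFin//;
    [|exact: measurable_funM|by move=> x Dx; rewrite mulr_ge0 ?D2// ltW].
  rewrite integral_cst// ge0_integralZl_cst//.
  rewrite {1}muDE -EFinM mulrDl EFinD; apply: leeD; first by rewrite lee_fin mulrC.
  have -> : (16 / 2 ^+ n)%:E = ((2 ^+ n)%:E * (16 * e n)%:E)%E.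
    rewrite -EFinM; congr EFin; rewrite /e (_ : 4 = 2 * 2)// ?exprMn -?natrM//.
    by field; rewrite gt_eqF.
  by rewrite lee_pmul2l// lte_fin.
pose F x := (\sum_(n <oo) (Dl n x)%:E)%E.
have Dl0 n x : (0 <= (Dl n x)%:E)%E by rewrite lee_fin; exact: normr_ge0.
have mEDl n : measurable_fun D (fun x => (Dl n x)%:E).
  by apply/measurable_EFinP; exact: measurable_funTS.
have mF : measurable_fun D F.
  apply: (emeasurable_fun_cvg (fun n x => (\sum_(0 <= i < n) (Dl i x)%:E)%E)).
    by move=> n; exact: emeasurable_sum.
  by move=> x _; apply: is_cvg_nneseries => n _ _; exact: Dl0.
have F_ae : {ae mu, forall x, D x -> F x \is a fin_num}.
  apply: integrable_ae => //; apply/integrableP; split => //.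
  have F0 x : (0 <= F x)%E by apply: nneseries_ge0 => n _ _; exact: Dl0.
  under eq_integral do rewrite gee0_abs//.
  rewrite integral_nneseries//.
  apply: le_lt_trans (ltry (2 * (fine (mu D) + 16) / 2 ^+ 0)).
  rewrite -(cvg_lim _ (@cvg_geometric_eseries_half R _ 0%N))//.
  apply: lee_nneseries => [n _ _|n _].
    by apply: integral_ge0 => x _; exact: Dl0.
  apply: (le_trans (Dl1 n)); rewrite lee_fin addn1 natrX exprS.
  rewrite [leRHS](_ : _ = (fine (mu D) + 16) / 2 ^+ n)//.
  by field; rewrite gt_eqF// exprn_gt0.
have L_ae : {ae mu, forall x, D x ->
    limn_einf (fun n => `|u_ n x|%:E) \is a fin_num}.
  have L0 x : (0 <= limn_einf (fun n => `|u_ n x|%:E))%E.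
    by apply: le_limn_einf => a /ltW a0; apply: nearW => n; exact: le_trans a0 _.
  have mau n : measurable_fun D (fun x => `|u_ n x|%:E).
    by apply/measurable_EFinP/measurable_funTS; exact: measurableT_comp.
  apply: integrable_ae => //; apply/integrableP; split => //.
    apply: measurableT_comp => //; apply: measurable_fun_limn_esup => n.
    exact: measurableT_comp.
  under eq_integral do rewrite gee0_abs//.
  apply: le_lt_trans (fatou _ _ _ _) _ => //.
  apply: (@le_lt_trans _ _ M%:E); last exact: ltry.
  rewrite limn_einf_lim; apply: lime_le; first exact: is_cvg_einfs.
  apply: nearW => n; apply: ge_ereal_inf.
  by exists (\int[mu]_(x in D) `|u_ n x|%:E)%E; [exists n => /=|exact/K_bnd/K0/Ku].
(* An upper limit, so that u is measurable everywhere. *)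
pose u x := fine (limn_esup (fun n => (u_ n x)%:E)).
exists u_, u; split => //.
  apply: measurableT_comp => //; apply: measurable_fun_limn_esup => n.
  exact/measurable_EFinP.
apply: filterS2 F_ae L_ae => x + + Dx => /(_ Dx) Fx /(_ Dx) Lx.
have cvg_tau : cvgn (tau \o u_ ^~ x).
  have : cvgn (series (telescope (tau \o u_ ^~ x))).
    apply: normed_cvg; apply: nnseries_is_cvg => [n|]; first exact: normr_ge0.
    by move: Fx; rewrite fin_numElt => /andP[].
  rewrite telescopeK => cv; rewrite (_ : tau \o _ = (fun n => tau (u_ n x) - tau (u_ 0%N x)) + cst (tau (u_ 0%N x))).
    by apply: is_cvgD; [exact: cv|exact: is_cvg_cst].
  by apply/funext => n; rewrite !fctE subrK.
have [l ul] : exists l : R, u_ ^~ x @ \oo --> l.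
  apply: (@cvg_of_tau _ _ (fine (limn_einf (fun n => `|u_ n x|%:E)) + 1)) => // n.
  apply: contrapT => /forall2NP noN.
  suff : ((fine (limn_einf (fun n => `|u_ n x|%:E)) + 1)%:E
           <= limn_einf (fun n => `|u_ n x|%:E))%E.
    by rewrite -[in leRHS](fineK Lx) lee_fin gerDl ler10.
  apply: le_limn_einf => a aL; exists n => // k /= nk.
  case: (noN k) => [//|/negP]; rewrite -ltNge => /ltW uk.
  by apply: (le_trans (ltW aL)); rewrite lee_fin.
suff -> : u x = l by [].
rewrite /u; have /cvg_limn_einf_sup[_ ->] // : (u_ n x)%:E @[n --> \oo] --> l%:E.
by apply: cvg_EFin => //; exact: nearW.
Qed.

End nested_convex.

(** * Integration along a reversible walk *)

Definition flip {T : Type} (z : T * T) := (z.2, z.1).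

Section walk_prod_integral.
Context {d} {R : realType} {X : measurableType d}.
Variables (nu : {measure set X -> \bar R}) (m : R.-pker X ~> X).
Local Notation W := (walk_prod nu m).
Local Open Scope ereal_scope.

Import HBNNSimple.

(** By the definition of the measure on the product this is the case of
    indicator functions, extended by linearity to simple functions. *)
Let fubini_nnsfun (f : {nnsfun X * X >-> R}) :
  \int[W]_z (f z)%:E = \int[nu]_x \int[m x]_y (f (x, y))%:E.
Proof.
have mker A : measurable A -> measurable_fun [set: X] (fun x => m x (xsection A x)).
  by move=> mA; apply: measurable_fun_xsection_finite_kernel; rewrite inE.
under [in LHS]eq_integral do rewrite fimfunE -fsumEFin//.
rewrite ge0_integral_fsum//; last 2 first.
  - by move=> r; exact/measurable_EFinP/measurableT_comp.
  - by move=> r z _; rewrite EFinM nnfun_muleindic_ge0.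
have inner x : \int[m x]_y (f (x, y))%:E =
    \sum_(r \in range f) r%:E * m x (xsection (f @^-1` [set r]) x).
  under eq_integral do rewrite fimfunE -fsumEFin//.
  rewrite ge0_integral_fsum//; last 2 first.
  - move=> r; apply/measurable_EFinP; apply: measurable_funM => //.
    exact: measurableT_comp.
  - by move=> r z _; rewrite EFinM nnfun_muleindic_ge0.
  apply: eq_fsbigr => r _.
  have -> : (fun y => (r * \1_(f @^-1` [set r]) (x, y))%:E) =
      (fun y => (r * \1_(xsection (f @^-1` [set r]) x) y)%:E).
    by apply/funext => y; rewrite !indicE mem_xsection.
  rewrite (integralZl_indic _ (fun r => xsection (f @^-1` [set r]) x))//.
  - by rewrite integral_indic ?setIT//; exact: measurable_xsection.
  - by move=> r0; rewrite preimage_nnfun0// xsection0.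
  - exact: measurable_xsection.
under [RHS]eq_integral do rewrite inner.
rewrite ge0_integral_fsum//; last 2 first.
- by move=> r; apply: measurable_funeM; exact: mker.
- move=> r x _; have [r0|r0] := leP 0%R r; first by rewrite mule_ge0// lee_fin.
  by rewrite preimage_nnfun0// xsection0 measure0 mule0.
apply: eq_fsbigr => r _.
rewrite (integralZl_indic _ (fun r => f @^-1` [set r]))//; last first.
  exact: preimage_nnfun0.
rewrite integral_indic// setIT.
have [r0|r0] := leP 0%R r.
  by rewrite ge0_integralZl//; [rewrite -walk_prodE|exact: mker].
rewrite preimage_nnfun0// measure0 mule0 integral0_eq// => x _.
by rewrite xsection0 measure0 mule0.
Qed.

Lemma walk_prod_tonelliT (f : X * X -> \bar R) : (forall z, 0 <= f z) ->
  measurable_fun [set: X * X] f ->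
  \int[W]_z f z = \int[nu]_x \int[m x]_y f (x, y).
Proof.
move=> f0 mf; pose f_ := nnsfun_approx measurableT mf.
have mfx n x : measurable_fun [set: X] (fun y => (f_ n (x, y))%:E).
  by apply/measurable_EFinP; exact: measurableT_comp.
have fx0 n x y : 0 <= (f_ n (x, y))%:E by rewrite lee_fin.
have ndf z : {homo (fun n => (f_ n z)%:E) : a b / (a <= b)%N >-> a <= b}.
  by move=> a b ab; rewrite lee_fin; exact/lefP/nd_nnsfun_approx.
have limf z : limn (fun n => (f_ n z)%:E) = f z.
  by apply/cvg_lim => //; exact: cvg_nnsfun_approx.
transitivity (\int[W]_z limn (fun n => (f_ n z)%:E)).
  by apply/eq_integral => z _; rewrite limf.
rewrite monotone_convergence//; [|by move=> n; exact/measurable_EFinP|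
  by move=> n z _; rewrite lee_fin].
rewrite (_ : (fun _ => _) =
    (fun n => \int[nu]_x \int[m x]_y (f_ n (x, y))%:E)); last first.
  by apply/funext => n; exact: fubini_nnsfun.
rewrite -monotone_convergence//; last 3 first.
- move=> n; apply: (@measurable_fun_integral_finite_kernel _ _ _ _ _ (EFin \o f_ n)).
    by move=> z; rewrite /= lee_fin.
  exact/measurable_EFinP.
- by move=> n x _; exact: integral_ge0.
- move=> x _ a b ab; apply: ge0_le_integral => // y _; exact: ndf.
apply: eq_integral => x _; rewrite -monotone_convergence//.
by apply: eq_integral => y _; rewrite limf.
Qed.

Variable Om : set X.
Hypothesis mOm : measurable Om.
Local Notation D := (Om `*` Om).

Let mD : measurable D. Proof. exact: measurableX. Qed.

Let patchX (f : X * X -> \bar R) x y :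
  (f \_ D) (x, y) = ((fun x => ((fun y => f (x, y)) \_ Om) y) \_ Om) x.
Proof. by rewrite !patchE in_setX; case: (x \in Om). Qed.

Let integral_patchX (f : X * X -> \bar R) x :
  \int[m x]_y (f \_ D) (x, y) = ((fun x => \int[m x]_(y in Om) f (x, y)) \_ Om) x.
Proof.
have [xOm|xOm] := boolP (x \in Om); rewrite [RHS]patchE.
  by under eq_integral do rewrite patchX patchE xOm; rewrite xOm [RHS]integral_mkcond.
rewrite (negbTE xOm) integral0_eq// => y _.
by rewrite patchX patchE (negbTE xOm).
Qed.

Lemma measurable_walk_integral (f : X * X -> \bar R) :
  (forall z, 0 <= f z) -> measurable_fun D f ->
  measurable_fun Om (fun x => \int[m x]_(y in Om) f (x, y)).
Proof.
move=> f0 mf; apply/(measurable_restrictT _ _).2 => //.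
rewrite (_ : _ \_ _ = fun x => \int[m x]_y (f \_ D) (x, y)); last first.
  by apply/funext => x; rewrite integral_patchX.
apply: (@measurable_fun_integral_finite_kernel _ _ _ _ _ (f \_ D)).
  by move=> z; exact: erestrict_ge0.
exact/(measurable_restrictT _ _).1.
Qed.

Lemma walk_prod_tonelli (f : X * X -> \bar R) : (forall z, 0 <= f z) ->
  measurable_fun D f ->
  \int[W]_(z in D) f z = \int[nu]_(x in Om) \int[m x]_(y in Om) f (x, y).
Proof.
move=> f0 mf; rewrite [LHS]integral_mkcond [RHS]integral_mkcond walk_prod_tonelliT.
- by apply: eq_integral => x _; exact: integral_patchX.
- by move=> z; exact: erestrict_ge0.
- exact/(measurable_restrictT _ _).1.
Qed.

Lemma walk_prod_fubini (f : X * X -> \bar R) : W.-integrable D f ->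
  nu.-integrable Om (fun x => \int[m x]_(y in Om) f (x, y)) /\
  \int[W]_(z in D) f z = \int[nu]_(x in Om) \int[m x]_(y in Om) f (x, y).
Proof.
move=> intf; have mf := measurable_int _ intf.
have mfp : measurable_fun D f^\+ by exact: measurable_funepos.
have mfn : measurable_fun D f^\- by exact: measurable_funeneg.
have h (g : X * X -> \bar R) : (forall z, 0 <= g z) -> W.-integrable D g ->
    nu.-integrable Om (fun x => \int[m x]_(y in Om) g (x, y)).
  move=> g0 ig; have mg := measurable_int _ ig.
  apply/integrableP; split; first exact: measurable_walk_integral.
  under eq_integral do rewrite gee0_abs ?integral_ge0//.
  by rewrite -walk_prod_tonelli//; exact: integrable_lty.
have ip := h _ (funepos_ge0 f) (integrable_funepos mD intf).
have im := h _ (funeneg_ge0 f) (integrable_funeneg mD intf).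
have E : (fun x => \int[m x]_(y in Om) f (x, y)) =
    (fun x => \int[m x]_(y in Om) f^\+ (x, y)) \-
    (fun x => \int[m x]_(y in Om) f^\- (x, y)).
  apply/funext => x; rewrite integralE.
  by congr (_ - _); apply: eq_integral => y _; rewrite ?funeposE ?funenegE.
rewrite E; split; first exact: integrableB.
by rewrite integralB// [LHS]integralE !walk_prod_tonelli.
Qed.

Lemma walk_prod_section_null (N : set (X * X)) : measurable N -> W N = 0 ->
  {ae nu, forall x, m x (xsection N x) = 0}.
Proof.
move=> mN; rewrite /= walk_prodE// => N0.
have mx : measurable_fun [set: X] (fun x => m x (xsection N x)).
  by apply: measurable_fun_xsection_finite_kernel; rewrite inE.
have /(ae_eq_integral_abs nu measurableT mx) : \int[nu]_x `|m x (xsection N x)| = 0.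
  by rewrite -N0; apply: eq_integral => x _; rewrite gee0_abs.
by apply: filterS => x; exact.
Qed.

Hypothesis hrev : reversible nu m.

Lemma measurable_flip : measurable_fun [set: X * X] (@flip X).
Proof. exact: measurable_swap. Qed.

(** This is reversibility, read as invariance under exchanging the two
    variables. *)
Lemma walk_prod_flip (A : set (X * X)) : measurable A ->
  W (@flip X @^-1` A) = W A.
Proof.
move=> mA; transitivity (\int[nu]_y \int[m y]_x (\1_A (x, y))%:E); last first.
  by rewrite -hrev.
apply: eq_integral => y _; apply: eq_integral => x _; rewrite !indicE.
by congr ((nat_of_bool _)%:R%:E); apply/idP/idP; rewrite !inE.
Qed.

Let flipD : @flip X @^-1` D = D.
Proof. by apply/seteqP; split => -[x y] []. Qed.

Lemma ge0_walk_prod_integral_flip (f : X * X -> \bar R) :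
  measurable_fun D f -> (forall z, 0 <= f z) ->
  \int[W]_(z in D) f (flip z) = \int[W]_(z in D) f z.
Proof.
move=> mf f0.
have := ge0_integral_pushforward measurable_flip W mD mf (fun z _ => f0 z).
rewrite flipD => <-; apply: eq_measure_integral; first exact: measurable_flip.
by move=> mf' A mA _; exact: walk_prod_flip.
Qed.

Lemma walk_prod_integral_flip (f : X * X -> \bar R) : measurable_fun D f ->
  \int[W]_(z in D) f (flip z) = \int[W]_(z in D) f z.
Proof.
move=> mf; rewrite [LHS]integralE [RHS]integralE.
rewrite -(ge0_walk_prod_integral_flip (measurable_funepos mf))//.
rewrite -(ge0_walk_prod_integral_flip (measurable_funeneg mf))//.
by congr (_ - _); apply: eq_integral => z _; rewrite ?funeposE ?funenegE.
Qed.

End walk_prod_integral.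

Section ae_walk.
Context {d} {R : realType} {X : measurableType d}.
Variables (nu : {measure set X -> \bar R}) (m : R.-pker X ~> X).
Hypothesis hrev : reversible nu m.

(** The first marginal of the measure on the product is nu, as each m x is a
    probability. *)
Let walk_prod_null_fst (N : set X) : measurable N -> nu N = 0%E ->
  walk_prod nu m (N `*` setT) = 0%E.
Proof.
move=> mN N0; rewrite /= walk_prodE; last exact: measurableX.
rewrite (@ae_eq_integral _ _ _ nu setT (cst 0%E)) ?integral0//.
  by apply: measurable_fun_xsection_finite_kernel; rewrite inE; exact: measurableX.
exists N; split => // x /= h; apply: contrapT => Nx; apply: h => _.
rewrite (_ : xsection _ _ = set0) ?measure0//.
by apply/seteqP; split => // y; rewrite /xsection /= inE => -[].
Qed.

(** Both marginals vanish on the null sets of nu: the second one equals the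
    first by reversibility. *)
Lemma ae_walk_prod (P : X -> Prop) : {ae nu, forall x, P x} ->
  {ae walk_prod nu m, forall z, P z.1 /\ P z.2}.
Proof.
move=> [N [mN N0 PN]].
have m1 : measurable (N `*` [set: X]) by exact: measurableX.
have W1 := walk_prod_null_fst mN N0.
have W2 : walk_prod nu m (@flip X @^-1` (N `*` [set: X])) = 0%E.
  by rewrite -W1; exact: walk_prod_flip.
have m2 : measurable (@flip X @^-1` (N `*` [set: X])).
  by rewrite -[X in measurable X]setTI; exact: measurable_flip.
exists (N `*` [set: X] `|` @flip X @^-1` (N `*` [set: X])); split.
- exact: measurableU.
- by rewrite null_set_setU.
- move=> [x y] /= /not_andP[h|h]; [left|right]; split => //=; exact: PN.
Qed.

End ae_walk.

(** * Superposition and primitives of monotone Caratheodory functions *)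

Section caratheodory.
Context {d} {T : measurableType d} {R : realType}.
Variable b : T -> R -> R.
Hypothesis mb : forall r, measurable_fun [set: T] (fun z => b z r).
Hypothesis cb : forall z, continuous (b z).

Let measurable_fun_step (w : T -> R) (n : nat) :
  measurable_fun [set: T] w ->
  measurable_fun [set: T]
    (fun z => b z ((Num.floor (n.+1%:R * w z))%:~R / n.+1%:R)).
Proof.
move=> mw _ Y mY; rewrite setTI.
pose E (k : int) := [set z | (k%:~R <= n.+1%:R * w z < (k + 1)%:~R)].
rewrite (_ : _ @^-1` _ = \bigcup_(k in [set: int])
    (E k `&` (fun z => b z (k%:~R / n.+1%:R)) @^-1` Y)); last first.
  apply/seteqP; split => [z Yz|z [k _ [/= Ek Yk]]].
    by exists (Num.floor (n.+1%:R * w z)) => //; split => //; exact: floor_itv.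
  suff -> : Num.floor (n.+1%:R * w z) = k by [].
  by apply/eqP; rewrite floor_eq.
apply: countable_bigcupT_measurable; first exact: countableP.
move=> k; apply: measurableI; last by rewrite -[X in measurable X]setTI; exact: mb.
rewrite (_ : E k = (fun z => n.+1%:R * w z) @^-1` `[k%:~R, (k + 1)%:~R[%classic).
  rewrite -[X in measurable X]setTI.
  by apply: (measurable_funM (measurable_cst _) mw).
by apply/seteqP; split => z /=; rewrite in_itv.
Qed.

(** When w takes countably many values, the composite is glued from countably
    many sections b(., r). The general case follows by rounding w down to
    multiples of 1/n and using continuity in r. *)
Lemma caratheodory_measurable (w : T -> R) : measurable_fun [set: T] w ->
  measurable_fun [set: T] (fun z => b z (w z)).
Proof.
move=> mw.
apply: (@measurable_fun_cvg _ _ _ _ (fun n z =>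
    b z ((Num.floor (n.+1%:R * w z))%:~R / n.+1%:R))).
  by move=> n; exact: measurable_fun_step.
move=> z _.
suff h : (Num.floor (n.+1%:R * w z))%:~R / n.+1%:R @[n --> \oo] --> w z.
  exact: (cvg_comp _ _ h (@cb z (w z))).
apply/cvgrPdist_le => e e0; near=> n.
have n0 : 0 < n.+1%:R :> R by [].
apply: (@le_trans _ _ n.+1%:R^-1); last first.
  by apply: ltW; near: n; exact: (near_infty_natSinv_lt (PosNum e0)).
have /andP[h1 h2] := floor_itv (n.+1%:R * w z).
set k := (Num.floor _)%:~R in h1 h2 *; rewrite intrD in h2.
have -> : w z - k / n.+1%:R = (n.+1%:R * w z - k) / n.+1%:R.
  by field; rewrite gt_eqF.
rewrite normrM (ger0_norm (_ : 0 <= n.+1%:R^-1))// ler_piMl//.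
by rewrite ger0_norm ?subr_ge0//; lra.
Unshelve. all: by end_near. Qed.

End caratheodory.

Section family_potential.
Context {T : Type} {R : realType}.
Variable b : T -> R -> R.
Hypothesis bmono : forall z r s, 0 <= (b z r - b z s) * (r - s).
Hypothesis b0 : forall z, b z 0 = 0.

Let graph z : R -> set R := fun r => [set b z r].

Let graph_mono z : monotone_graph (graph z).
Proof. by move=> r s _ _ -> ->. Qed.

Let graph0 z : graph z 0 0. Proof. by rewrite /graph /= b0. Qed.

(** The graph of r |-> b z r is single-valued with full domain, so its potential
    is finite: it is the integral of b z from 0 to r. *)
Definition primitive z r : R := fine (potential (fun r => [set b z r]) r).

Let primitiveE z r : potential (graph z) r = (primitive z r)%:E.
Proof. by rewrite fineK//; exact: (potential_fin (@graph_mono z) (graph0 z) (erefl _)). Qed.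

Lemma primitive_ge0 z r : 0 <= primitive z r.
Proof. by rewrite -lee_fin -primitiveE potential_ge0. Qed.

Lemma primitive0 z : primitive z 0 = 0.
Proof. by apply: EFin_inj; rewrite -primitiveE potential0. Qed.

Lemma primitive_subgradient z r s :
  primitive z r + b z r * (s - r) <= primitive z s.
Proof.
rewrite -lee_fin EFinD -!primitiveE.
by apply: potential_subgradient.
Qed.

Lemma primitive_le z r : primitive z r <= b z r * r.
Proof. by have := primitive_subgradient z r 0; rewrite primitive0; lra. Qed.

Lemma primitive_le_liminf z (u_ : R^nat) (u : R) : u_ @ \oo --> u ->
  ((primitive z u)%:E <= limn_einf (fun n => (primitive z (u_ n))%:E))%E.
Proof.
move=> /(potential_le_liminf (graph z)); rewrite primitiveE.
by under [X in limn_einf X]eq_fun do rewrite primitiveE.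
Qed.

Lemma primitive_midpoint z r s :
  primitive z ((r + s) / 2) <= primitive z r / 2 + primitive z s / 2.
Proof.
have := primitive_subgradient z ((r + s) / 2) r.
have := primitive_subgradient z ((r + s) / 2) s; nra.
Qed.

(** The supremum over chains that defines the primitive is uncountable; as a
    limit of Riemann sums the primitive depends measurably on z. *)
Definition riemann_sum (n : nat) z r : R :=
  \sum_(0 <= k < n.+1) b z (r * (k%:R / n.+1%:R)) * (r / n.+1%:R).

(** On each subinterval the increment of the primitive lies between the values
    of b z at the end points times the length; the difference of the two
    resulting sums telescopes. *)
Lemma riemann_sum_bounds n z r :
  riemann_sum n z r <= primitive z r <= riemann_sum n z r + b z r * r / n.+1%:R.
Proof.
have n0 : n.+1%:R != 0 :> R by [].
pose t k : R := r * (k%:R / n.+1%:R).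
have t0 : t 0%N = 0 by rewrite /t mul0r mulr0.
have tn : t n.+1 = r by rewrite /t divff// mulr1.
have dt k : t k.+1 - t k = r / n.+1%:R.
  by rewrite /t -mulrBr -mulrBl -natrB// subSnn mul1r.
have <- : \sum_(0 <= k < n.+1) (primitive z (t k.+1) - primitive z (t k)) = primitive z r.
  by rewrite telescope_sumr// tn t0 primitive0 subr0.
apply/andP; split.
  apply: ler_sum => k _; have := primitive_subgradient z (t k) (t k.+1).
  by rewrite dt -lerBrDl.
have -> : b z r * r / n.+1%:R =
    \sum_(0 <= k < n.+1) (b z (t k.+1) - b z (t k)) * (r / n.+1%:R).
  by rewrite -mulr_suml telescope_sumr// tn t0 b0 subr0 mulrA.
rewrite /riemann_sum -big_split/=; apply: ler_sum => k _.
have := primitive_subgradient z (t k.+1) (t k).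
rewrite -[t k - _]opprB dt -/(t k) => h.
rewrite [leRHS](_ : _ = b z (t k.+1) * (r / n.+1%:R)); last by ring.
by move: h; rewrite mulrN lerBlDl -lerBlDr; exact: le_trans.
Qed.

Lemma riemann_sum_cvg z r : riemann_sum n z r @[n --> \oo] --> primitive z r.
Proof.
apply/cvgrPdist_le => e e0; near=> n.
have /andP[h1 h2] := riemann_sum_bounds n z r.
rewrite ger0_norm ?subr_ge0//.
apply: (@le_trans _ _ (b z r * r / n.+1%:R)); first by rewrite lerBlDl.
near: n; have : (b z r * r) *: (harmonic n : R) @[n --> \oo] --> (b z r * r) *: (0 : R).
  by apply: cvgZr; exact: cvg_harmonic.
rewrite scaler0 => /cvgr_le; apply.
by [].
Unshelve. all: by end_near. Qed.

End family_potential.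

Lemma measurable_primitive {d} {T : measurableType d} {R : realType}
    (b : T -> R -> R) (w : T -> R) :
  (forall r, measurable_fun [set: T] (fun z => b z r)) ->
  (forall z, continuous (b z)) ->
  (forall z r s, 0 <= (b z r - b z s) * (r - s)) -> (forall z, b z 0 = 0) ->
  measurable_fun [set: T] w ->
  measurable_fun [set: T] (fun z => primitive b z (w z)).
Proof.
move=> mb cb bmono b0 mw.
apply: (@measurable_fun_cvg _ _ _ _ (fun n z => riemann_sum b n z (w z))).
  move=> n; apply: measurable_sum => k; apply: measurable_funM.
    apply: caratheodory_measurable => //; exact: measurable_funM.
  exact: measurable_funM.
by move=> z _; exact: riemann_sum_cvg.
Qed.

(** * Power inequalities *)

Section power_inequalities.
Context {R : realType}.
Variables (p : R) (hp : 1 < p).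
Local Notation q := (p / (p - 1)).
Implicit Types x y r s : R.

Let p0 : 0 < p. Proof. by apply: lt_trans hp. Qed.
Let pn0 : p != 0. Proof. by rewrite gt_eqF. Qed.
Let p10 : 0 < p - 1. Proof. by rewrite subr_gt0. Qed.

Lemma conj_exp_ge1 : 1 <= q.
Proof. by rewrite ler_pdivlMr// mul1r gerBl. Qed.

Lemma conj_exp_gt0 : 0 < q. Proof. exact: lt_le_trans conj_exp_ge1. Qed.

Lemma young x y : 0 <= x -> 0 <= y -> x * y <= x `^ p + y `^ q.
Proof.
move=> x0 y0.
have h : p^-1 + q^-1 = 1 by field; rewrite pn0 gt_eqF.
apply: (le_trans (conjugate_powR x0 y0 p0 conj_exp_gt0 h)).
apply: lerD; rewrite ler_piMr ?powR_ge0// invf_le1 ?conj_exp_ge1 ?conj_exp_gt0//.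
exact: ltW.
Qed.

(** Scaling x by the p-th root of e makes the constant in front of x `^ p as
    small as required. *)
Lemma young_eps e : 0 < e -> exists2 C, 0 <= C &
  forall x y, 0 <= x -> 0 <= y -> x * y <= e * x `^ p + C * y `^ q.
Proof.
move=> e0; pose t := e `^ p^-1; have t0 : 0 < t by exact: powR_gt0.
exists (t^-1 `^ q); first exact: powR_ge0.
move=> x y x0 y0.
have -> : x * y = (t * x) * (t^-1 * y) by field; rewrite gt_eqF.
have ti0 : 0 <= t^-1 by rewrite invr_ge0 ltW.
apply: (le_trans (young _ _)); rewrite ?mulr_ge0 ?(ltW t0)//.
by rewrite !powRM// ?(ltW t0)// /t -powRrM mulVf// powRr1// ltW.
Qed.

Lemma powRD_le x y (e : R) : 0 <= e -> 0 <= x -> 0 <= y ->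
  (x + y) `^ e <= 2 `^ e * (x `^ e + y `^ e).
Proof.
move=> e0 x0 y0; wlog xy : x y x0 y0 / x <= y.
  move=> H; have [xy|/ltW yx] := leP x y; first exact: H.
  by rewrite addrC [X in _ * X]addrC; exact: H.
apply: (@le_trans _ _ ((2 * y) `^ e)).
  by apply: ge0_ler_powR => //; rewrite ?nnegrE ?addr_ge0// ?mulr_ge0//; lra.
by rewrite powRM// ler_wpM2l ?powR_ge0// lerDr powR_ge0.
Qed.

Lemma powR_normB_le x y :
  `|x - y| `^ p <= 2 `^ p * (`|x| `^ p + `|y| `^ p).
Proof.
apply: le_trans (powRD_le (ltW p0) (normr_ge0 x) (normr_ge0 y)).
by apply: ge0_ler_powR; rewrite ?nnegrE ?addr_ge0 ?(ltW p0) ?ler_normB.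
Qed.

Lemma powR_normD_le x y :
  `|x + y| `^ p <= 2 `^ p * (`|x| `^ p + `|y| `^ p).
Proof. by have := powR_normB_le x (- y); rewrite opprK normrN. Qed.

(** The exponents satisfy (p - 1) q = p: growth of order p - 1 is what maps L^p
    to L^q. *)
Lemma growth_powR C r s : 0 <= C -> `|s| <= C * (1 + `|r| `^ (p - 1)) ->
  `|s| `^ q <= (2 * C) `^ q * (1 + `|r| `^ p).
Proof.
move=> C0 h; have q0 := ltW conj_exp_gt0.
have g0 : 0 <= 1 + `|r| `^ (p - 1) by rewrite addr_ge0// powR_ge0.
apply: (@le_trans _ _ ((C * (1 + `|r| `^ (p - 1))) `^ q)).
  by apply: ge0_ler_powR; rewrite // nnegrE// mulr_ge0.
rewrite powRM//.
have := powRD_le q0 (@ler01 R) (powR_ge0 `|r| (p - 1)).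
rewrite powR1 -powRrM mulrCA mulfV ?gt_eqF// mulr1 => h2.
by rewrite (powRM _ _ C0)// [2 `^ _ * _]mulrC -mulrA ler_wpM2l ?powR_ge0.
Qed.

Lemma powR_le1D x (e : R) : 0 <= e -> e <= p -> 0 <= x -> x `^ e <= 1 + x `^ p.
Proof.
move=> e0 ep x0; have [x1|/ltW x1] := leP x 1.
  apply: (@le_trans _ _ 1); last by rewrite lerDl powR_ge0.
  by have := ge0_ler_powR e0 x0 (@ler01 R) x1; rewrite powR1.
by apply: (@le_trans _ _ (x `^ p)); [exact: ler_powR|rewrite lerDr].
Qed.

Lemma continuous_powR_norm : continuous (fun x : R => `|x| `^ p).
Proof.
have c0 : `|y| `^ p @[y --> (0 : R)] --> (0 : R).
  apply/cvgrPdist_le => e e0.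
  near=> y; rewrite sub0r normrN (ger0_norm (powR_ge0 _ _)).
  have ye : `|y| <= e by near: y; exact: (@nbhs0_le R R _ e0).
  have y1 : `|y| <= 1 by near: y; exact: (@nbhs0_le R R _ ltr01).
  apply: le_trans ye; have := normr_ge0 y; rewrite le_eqVlt => /predU1P[<-|y0].
    by rewrite powR0.
  by apply: ge1r_powR; [rewrite y0|exact: ltW].
move=> x; have [->|x0] := eqVneq x 0.
  by rewrite /continuous_at normr0 powR0.
rewrite (_ : (fun x : R => `|x| `^ p) = (fun x => x `^ p) \o Num.norm)//.
apply: continuous_comp; first exact: norm_continuous.
apply: differentiable_continuous; apply/derivable1_diffP.
by apply: derivable_powR; rewrite in_itv/= andbT normr_gt0.
Unshelve. all: by end_near. Qed.

End power_inequalities.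

(** * Functions with integrable powers *)

Section Lp_functions.
Context {d} {T : measurableType d} {R : realType}.
Variables (mu : {measure set T -> \bar R}) (D : set T) (mD : measurable D).
Variables (p : R) (hp : 1 < p).
Local Notation q := (p / (p - 1)).
Implicit Types f g u v w : T -> R.

Lemma le_integrable_EFin f g : measurable_fun [set: T] f ->
  mu.-integrable D (EFin \o g) -> (forall x, D x -> `|f x| <= g x) ->
  mu.-integrable D (EFin \o f).
Proof.
move=> mf ig fg; apply: le_integrable ig => //.
  by apply/measurable_EFinP; exact: measurable_funTS.
by move=> x Dx /=; rewrite lee_fin (le_trans (fg x Dx)) ?ler_norm.
Qed.

Lemma ge0_integrable_EFin f : measurable_fun [set: T] f ->
  (forall x, 0 <= f x) -> (\int[mu]_(x in D) (f x)%:E < +oo)%E ->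
  mu.-integrable D (EFin \o f).
Proof.
move=> mf f0 foo; apply/integrableP; split.
  by apply/measurable_EFinP; exact: measurable_funTS.
by under eq_integral do rewrite /= ger0_norm//.
Qed.

Lemma integral_EFinE f : mu.-integrable D (EFin \o f) ->
  (\int[mu]_(x in D) (f x)%:E = (\int[mu]_(x in D) f x)%:E)%E.
Proof. by move=> fi; rewrite fineK// integrable_fin_num. Qed.

Lemma integrableD_EFin f g : mu.-integrable D (EFin \o f) ->
  mu.-integrable D (EFin \o g) -> mu.-integrable D (EFin \o (fun x => f x + g x)).
Proof. by move=> fi gi; exact: (integrableD mD fi gi). Qed.

Lemma integrableB_EFin f g : mu.-integrable D (EFin \o f) ->
  mu.-integrable D (EFin \o g) -> mu.-integrable D (EFin \o (fun x => f x - g x)).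
Proof. by move=> fi gi; exact: (integrableB mD fi gi). Qed.

Lemma integrableZ_EFin c f : mu.-integrable D (EFin \o f) ->
  mu.-integrable D (EFin \o (fun x => c * f x)).
Proof. by move=> fi; exact: (integrableZl mD c fi). Qed.

(** Functions rather than classes, measurable on the whole space: they can be
    composed, evaluated at one variable of a product and modified on a set,
    without change of representative. *)
Definition Lp_fun u := measurable_fun [set: T] u /\
  mu.-integrable D (EFin \o (fun x => `|u x| `^ p)).

Lemma measurable_powR_norm (e : R) u : measurable_fun [set: T] u ->
  measurable_fun [set: T] (fun x => `|u x| `^ e).
Proof.
move=> mu'; apply: (@measurableT_comp _ _ _ _ _ _ (@powR R ^~ e)).
  exact: measurable_powR.
exact: measurableT_comp.
Qed.

Lemma Lp_funD u v : Lp_fun u -> Lp_fun v -> Lp_fun (fun x => u x + v x).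
Proof.
move=> [mU iU] [mV iV].
have mUV : measurable_fun [set: T] (fun x => u x + v x) by exact: measurable_funD.
split=> //; apply: le_integrable_EFin (measurable_powR_norm _ mUV)
  (integrableZ_EFin (2 `^ p) (integrableD_EFin iU iV)) _ => x _.
by rewrite ger0_norm ?powR_ge0// powR_normD_le.
Qed.

Lemma Lp_funZ c u : Lp_fun u -> Lp_fun (fun x => c * u x).
Proof.
move=> [mU iU].
have mcU : measurable_fun [set: T] (fun x => c * u x) by exact: measurable_funM.
split=> //; apply: le_integrable_EFin (measurable_powR_norm _ mcU)
  (integrableZ_EFin (`|c| `^ p) iU) _ => x _.
by rewrite ger0_norm ?powR_ge0// normrM powRM.
Qed.

Lemma Lp_funB u v : Lp_fun u -> Lp_fun v -> Lp_fun (fun x => u x - v x).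
Proof.
move=> hu /(Lp_funZ (-1)) hv.
rewrite (_ : (fun x => _) = (fun x => u x + -1 * v x)); first exact: Lp_funD.
by apply/funext => x; rewrite mulN1r.
Qed.

Lemma integrable_mul_Lp_conj u f : Lp_fun u -> measurable_fun [set: T] f ->
  mu.-integrable D (EFin \o (fun x => `|f x| `^ q)) ->
  mu.-integrable D (EFin \o (fun x => f x * u x)).
Proof.
move=> [mU iU] mf iF; apply: le_integrable_EFin (integrableD_EFin iU iF) _.
  exact: measurable_funM.
by move=> x _; rewrite normrM mulrC young.
Qed.

Hypothesis muD : (mu D < +oo)%E.

Lemma integrable_cst_EFin (c : R) : mu.-integrable D (EFin \o (fun=> c)).
Proof.
apply/integrableP; split; first exact/measurable_EFinP.
rewrite (_ : (fun x => _) = cst `|c|%:E)// integral_cst//.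
by rewrite lte_mul_pinfty// lee_fin.
Qed.

Lemma measurable_fun_in (E : set T) : measurable E ->
  measurable_fun [set: T] (fun x => x \in E).
Proof.
move=> mE; apply: (measurable_fun_bool true); rewrite setTI.
by rewrite (_ : _ @^-1` _ = E)//; apply/seteqP; split => x /= => [/set_mem|/mem_set].
Qed.

Lemma Lp_fun_integrable u : Lp_fun u -> mu.-integrable D (EFin \o u).
Proof.
move=> [mU iU].
apply: le_integrable_EFin mU (integrableD_EFin (integrable_cst_EFin 1) iU) _ => x _.
have := @powR_le1D _ p `|u x| 1 ler01 (ltW hp) (normr_ge0 _).
by rewrite powRr1.
Qed.

Lemma Lp_fun_cst c : Lp_fun (fun=> c).
Proof. by split => //; exact: integrable_cst_EFin. Qed.

Lemma Lp_fun_if u c (E : set T) : measurable E -> Lp_fun u ->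
  Lp_fun (fun x => if x \in E then c else u x).
Proof.
move=> mE [mU iU].
have mif : measurable_fun [set: T] (fun x => if x \in E then c else u x).
  apply: measurable_fun_ifT => //; exact: measurable_fun_in.
split => //; apply: le_integrable_EFin (measurable_powR_norm _ mif)
  (integrableD_EFin (integrable_cst_EFin (`|c| `^ p)) iU) _ => x _.
rewrite ger0_norm ?powR_ge0//; case: ifP => _.
  by rewrite lerDl powR_ge0.
by rewrite lerDr powR_ge0.
Qed.

Lemma Lp_fun_bounded_conj f (B : R) : measurable_fun [set: T] f ->
  (forall x, `|f x| <= B) -> mu.-integrable D (EFin \o (fun x => `|f x| `^ q)).
Proof.
move=> mf fB.
apply: le_integrable_EFin (measurable_powR_norm _ mf)
  (integrable_cst_EFin (B `^ q)) _ => x _.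
rewrite ger0_norm ?powR_ge0// ge0_ler_powR ?nnegrE ?(ltW (conj_exp_gt0 hp))//.
exact: le_trans (fB x).
Qed.

End Lp_functions.

(** For a measure of mass at most 1. With s the integral of |f|, Young's
    inequality for |f| and the constant (s/2)^(e - 1) bounds 2 (s/2)^e by the
    integral of |f|^e plus (s/2)^e. *)
Lemma powR_norm_integral_le {d} {T : measurableType d} {R : realType}
    (mu : {measure set T -> \bar R}) (D : set T) (mD : measurable D)
    (e : R) (f : T -> R) : 1 < e -> (mu D <= 1)%E -> Lp_fun mu D e f ->
  `|\int[mu]_(x in D) f x| `^ e <= 2 `^ e * \int[mu]_(x in D) (`|f x| `^ e).
Proof.
move=> he mu1 hf; have [mf fe] := hf.
have muD : (mu D < +oo)%E by apply: le_lt_trans mu1 _; rewrite ltry.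
have e0 : 0 < e by exact: lt_trans he.
have fi := Lp_fun_integrable mD he muD hf.
have afi := integrable_norm fi.
pose s := \int[mu]_(x in D) `|f x|.
have s0 : 0 <= s by apply: Rintegral_ge0.
have s20 : 0 <= s / 2 by rewrite divr_ge0.
pose y := (s / 2) `^ (e - 1).
have y0 : 0 <= y by exact: powR_ge0.
have sy : s * y = 2 * (s / 2) `^ e.
  by rewrite -(mulr_powRB1 s20 e0) /y; field.
have ye : y `^ (e / (e - 1)) = (s / 2) `^ e.
  by rewrite /y -powRrM mulrCA mulfV ?mulr1// gt_eqF// subr_gt0.
have key : s * y <= \int[mu]_(x in D) (`|f x| `^ e) + (s / 2) `^ e.
  have ic := integrable_cst_EFin mD muD ((s / 2) `^ e).
  apply: (@le_trans _ _ (\int[mu]_(x in D) (`|f x| `^ e + (s / 2) `^ e))).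
    rewrite mulrC -RintegralZl//; apply: le_Rintegral => //.
    - exact: integrableZ_EFin.
    - exact: integrableD_EFin.
    - by move=> x _; rewrite mulrC -ye young.
  rewrite RintegralD// lerD2l Rintegral_cst// ler_piMr ?powR_ge0//.
  by rewrite -lee_fin fineK// ge0_fin_numE.
have : `|\int[mu]_(x in D) f x| <= s by exact: le_normr_Rintegral.
move=> h; apply: (@le_trans _ _ (s `^ e)).
  by apply: ge0_ler_powR; rewrite ?nnegrE ?(ltW e0).
have -> : s = 2 * (s / 2) by field.
by rewrite powRM// ler_wpM2l ?powR_ge0//; move: key; rewrite sy; lra.
Qed.

(** * Differences along the walk *)

Section walk_differences.
Context {d} {R : realType} {X : measurableType d}.
Variables (nu : {measure set X -> \bar R}) (m : R.-pker X ~> X).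
Hypothesis hrev : reversible nu m.
Variables (Om : set X) (mOm : measurable Om).
Hypothesis nuOm : (nu Om < +oo)%E.
Variables (p : R) (hp : 1 < p).
Local Notation q := (p / (p - 1)).
Local Notation W := (walk_prod nu m).
Local Notation D := (Om `*` Om).

Let mD : measurable D. Proof. exact: measurableX. Qed.

Lemma kernel_le1 x : (m x Om <= 1)%E.
Proof.
by rewrite -(@prob_kernel _ _ _ _ _ m x) le_measure// inE.
Qed.

Lemma integrable_walk_fst (f : X -> R) : measurable_fun [set: X] f ->
  (forall x, 0 <= f x) -> nu.-integrable Om (EFin \o f) ->
  W.-integrable D (EFin \o (fun z => f z.1)).
Proof.
move=> mf f0 iF.
have mf1 : measurable_fun [set: X * X] (fun z : X * X => f z.1).
  exact: measurableT_comp.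
apply: ge0_integrable_EFin => //.
have f10 (z : X * X) : (0 <= (f z.1)%:E)%E by rewrite lee_fin.
rewrite (@walk_prod_tonelli _ _ _ _ _ _ mOm (fun z => (f z.1)%:E))//; last first.
  by apply/measurable_EFinP; exact: measurable_funTS.
apply: le_lt_trans (integrable_lty mOm iF).
apply: ge0_le_integral => //.
- by move=> x _; apply: integral_ge0 => y _; rewrite lee_fin.
- apply: (@measurable_walk_integral _ _ _ _ _ mOm (fun z => (f z.1)%:E)).
    by move=> z; rewrite lee_fin.
  by apply/measurable_EFinP; exact: measurable_funTS.
- by apply/measurable_EFinP; exact: measurable_funTS.
- move=> x _ /=; rewrite integral_cst// -[leRHS]mule1.
  by rewrite lee_wpmul2l ?lee_fin// kernel_le1.
Qed.

Lemma integrable_walk_snd (f : X -> R) : measurable_fun [set: X] f ->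
  (forall x, 0 <= f x) -> nu.-integrable Om (EFin \o f) ->
  W.-integrable D (EFin \o (fun z => f z.2)).
Proof.
move=> mf f0 iF.
have mf2 : measurable_fun [set: X * X] (fun z : X * X => f z.2).
  exact: measurableT_comp.
apply: ge0_integrable_EFin => //.
have f20 (z : X * X) : (0 <= (f z.2)%:E)%E by rewrite lee_fin.
rewrite -(@ge0_walk_prod_integral_flip _ _ _ _ _ _ mOm hrev (fun z => (f z.2)%:E))//; last first.
  by apply/measurable_EFinP; exact: measurable_funTS.
exact: integrable_lty (integrable_walk_fst mf f0 iF).
Qed.

Lemma walk_prod_finite : (W D < +oo)%E.
Proof.
have := @integrable_walk_fst (fun=> 1) _ _ _.
move=> /(_ (measurable_cst _) (fun=> ler01) (integrable_cst_EFin mOm nuOm 1)).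
move=> /(integrable_lty mD).
by rewrite (_ : (fun x => _) = cst 1%E)// integral_cst// mul1e.
Qed.

Definition diff (u : X -> R) (z : X * X) : R := u z.2 - u z.1.

Lemma measurable_diff u : measurable_fun [set: X] u ->
  measurable_fun [set: X * X] (diff u).
Proof. by move=> mu; apply: measurable_funB; exact: measurableT_comp. Qed.

Lemma Lp_fun_diff u : Lp_fun nu Om p u -> Lp_fun W D p (diff u).
Proof.
move=> [mu iu]; have mp := measurable_powR_norm p mu.
apply: Lp_funB => //; split; try exact: measurableT_comp.
  exact: (integrable_walk_snd mp).
exact: (integrable_walk_fst mp).
Qed.

End walk_differences.

(** * Flux and stored energy *)

(** With these conditions at every point, compositions with the flux and its
    primitive are measurable, finite and continuous everywhere. Coercivity is
    incompatible with setting the flux to 0 on a null set, and is only required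
    off that set. *)
Record regular_flux {d} {R : realType} {X : measurableType d}
    (nu : {measure set X -> \bar R}) (m : R.-pker X ~> X) (p c C : R)
    (b : X * X -> R -> R) (N : set (X * X)) : Prop := RegularFlux {
  rf_C0 : 0 <= C ;
  rf_c0 : 0 < c ;
  rf_meas : forall r, measurable_fun [set: X * X] (fun z => b z r) ;
  rf_cont : forall z, continuous (b z) ;
  rf_mono : forall z r s, 0 <= (b z r - b z s) * (r - s) ;
  rf_zero : forall z, b z 0 = 0 ;
  rf_growth : forall z r, `|b z r| <= C * (1 + `|r| `^ (p - 1)) ;
  rf_coercive : forall z, ~ N z -> forall r, c * `|r| `^ p <= b z r * r ;
  rf_anti : forall z r, b z r = - b (flip z) (- r) ;
  rf_measN : measurable N ;
  rf_null : walk_prod nu m N = 0%E }.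

Section energy.
Context {d} {R : realType} {X : measurableType d}.
Variables (nu : {measure set X -> \bar R}) (m : R.-pker X ~> X).
Hypothesis hrev : reversible nu m.
Variables (Om : set X) (mOm : measurable Om).
Hypothesis nuOm : (nu Om < +oo)%E.
Variables (p : R) (hp : 1 < p).
Local Notation q := (p / (p - 1)).
Local Notation W := (walk_prod nu m).
Local Notation D := (Om `*` Om).
Variables (b : X * X -> R -> R) (C c : R) (N : set (X * X)).
Hypothesis hb : regular_flux nu m p c C b N.

Let C0 := rf_C0 hb.
Let c0 := rf_c0 hb.
Let mb := rf_meas hb.
Let cb := rf_cont hb.
Let bmono := rf_mono hb.
Let b0 := rf_zero hb.
Let bgrowth := rf_growth hb.
Let bcoer := rf_coercive hb.
Let mN := rf_measN hb.
Let N0 := rf_null hb.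

Let mD : measurable D. Proof. exact: measurableX. Qed.

Definition flux u z := b z (diff u z).
Definition stored u z := primitive b z (diff u z).

Lemma measurable_flux u : measurable_fun [set: X] u ->
  measurable_fun [set: X * X] (flux u).
Proof. by move=> mu; apply: caratheodory_measurable => //; exact: measurable_diff. Qed.

Lemma measurable_stored u : measurable_fun [set: X] u ->
  measurable_fun [set: X * X] (stored u).
Proof. by move=> mu; apply: measurable_primitive => //; exact: measurable_diff. Qed.

Lemma flux_conj_integrable u : Lp_fun nu Om p u ->
  W.-integrable D (EFin \o (fun z => `|flux u z| `^ q)).
Proof.
move=> hu; have [mU iU] := Lp_fun_diff hrev mOm hp hu; have [mu _] := hu.
have i1 := integrable_cst_EFin mD (walk_prod_finite m mOm nuOm) 1.
apply: le_integrable_EFin (measurable_powR_norm _ (measurable_flux mu))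
  (integrableZ_EFin mD ((2 * C) `^ q) (integrableD_EFin mD i1 iU)) _ => // z _.
by rewrite ger0_norm ?powR_ge0//; exact: (growth_powR hp C0 (bgrowth _ _)).
Qed.

Lemma flux_mul_integrable u h : Lp_fun nu Om p u -> Lp_fun W D p h ->
  W.-integrable D (EFin \o (fun z => flux u z * h z)).
Proof.
move=> hu hh; apply: (integrable_mul_Lp_conj mD hp hh).
  by apply: measurable_flux; case: hu.
exact: flux_conj_integrable.
Qed.

Lemma stored_integrable u : Lp_fun nu Om p u ->
  W.-integrable D (EFin \o stored u).
Proof.
move=> hu; have hU := Lp_fun_diff hrev mOm hp hu; have [mu _] := hu.
apply: le_integrable_EFin (measurable_stored mu) (flux_mul_integrable hu hU) _ => // z _.
by rewrite ger0_norm ?primitive_ge0// primitive_le.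
Qed.

Let k := c * 2^-1 `^ p.

(** The tangent at r/2 bounds the primitive from below, so the primitive at r is
    at least b(r/2) r/2. *)
Lemma primitive_coercive z r : ~ N z -> k * `|r| `^ p <= primitive b z r.
Proof.
move=> Nz; have := primitive_subgradient bmono b0 z (r / 2) r.
have := primitive_ge0 bmono b0 z (r / 2).
have := bcoer Nz (r / 2).
rewrite normrM (ger0_norm (_ : 0 <= 2^-1))// powRM// => h1 h2 h3.
have -> : k * `|r| `^ p = c * (`|r| `^ p * 2^-1 `^ p) by rewrite /k; ring.
apply: (le_trans h1); apply: le_trans h3; rewrite -[leLHS]add0r lerD//.
by rewrite le_eqVlt; apply/orP; left; apply/eqP; field.
Qed.

Lemma stored_ge u : Lp_fun nu Om p u ->
  ((k * \int[W]_(z in D) (`|diff u z| `^ p))%:E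
    <= \int[W]_(z in D) (stored u z)%:E)%E.
Proof.
move=> hu; have [mU iU] := Lp_fun_diff hrev mOm hp hu; have [mu _] := hu.
rewrite EFinM -integral_EFinE// -ge0_integralZl_cst//.
- apply: ae_ge0_le_integral => //.
  + by move=> z _; rewrite lee_fin mulr_ge0// ?powR_ge0// mulr_ge0 ?powR_ge0// ltW.
  + by apply/measurable_EFinP/measurable_funTS; apply: measurable_funM => //; exact: measurable_powR_norm.
  + by move=> z _; rewrite lee_fin; exact: primitive_ge0.
  + by apply/measurable_EFinP; apply: measurable_funTS; exact: measurable_stored.
  + exists N; split => // z /=; apply: contra_notP => Nz _.
    by rewrite lee_fin; exact: primitive_coercive.
- by apply: measurable_funTS; exact: measurable_powR_norm.
- by rewrite mulr_ge0 ?powR_ge0// ltW.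
Qed.

End energy.

(** * The Poincare inequality for centred functions *)

Section in_Lp_integrable.
Context {d} {T : measurableType d} {R : realType}.
Variables (mu : {measure set T -> \bar R}) (D : set T) (mD : measurable D).
Variables (e : R) (he : 0 < e).
Implicit Types f g : T -> R.

Lemma poweR_Lnorm_restrict f :
  ('N[mu]_(e%:E)[EFin \o (f \_ D)] `^ e = \int[mu]_(x in D) (`|f x| `^ e)%:E)%E.
Proof.
rewrite poweR_Lnorm ?gt_eqF// [RHS]integral_mkcond; apply: eq_integral => x _.
rewrite /= !patchE; case: ifP => _ //.
by rewrite /= (_ : point = 0 :> R)// normr0 powR0 ?gt_eqF.
Qed.

Lemma in_LpI f g : measurable_fun [set: T] g ->
  mu.-integrable D (EFin \o (fun x => `|g x| `^ e)) ->
  f = g %[ae mu in D] -> in_Lp mu e D f.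
Proof.
move=> mg ig fg; exists g => //; rewrite inE; apply/andP; split; rewrite inE /=.
  apply: (measurable_restrictT _ mD).1; exact: measurable_funTS.
rewrite /finite_norm; apply: (@lty_poweRy _ _ e); first by rewrite gt_eqF.
by rewrite poweR_Lnorm_restrict; exact: integrable_lty.
Qed.

(** Extending the representative by 0 outside D makes it measurable on the whole
    space. *)
Lemma in_LpE f : in_Lp mu e D f -> exists2 g : T -> R,
  measurable_fun [set: T] g /\ mu.-integrable D (EFin \o (fun x => `|g x| `^ e)) &
  f = g %[ae mu in D].
Proof.
case=> g; rewrite inE => /andP[]; rewrite !inE /= => mg.
move=> /(@poweR_lty _ _ e); rewrite poweR_Lnorm_restrict => gfin fg.
have gD x : D x -> (g \_ D) x = g x by move=> Dx; rewrite patchE mem_set.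
exists (g \_ D).
  split=> //; apply/integrableP; split.
    apply/measurable_EFinP; apply: measurable_funTS.
    apply: (@measurableT_comp _ _ _ _ _ _ (@powR R ^~ e)); first exact: measurable_powR.
    exact: measurableT_comp.
  apply: le_lt_trans gfin; rewrite le_eqVlt; apply/orP; left; apply/eqP.
  apply: eq_integral => x /set_mem Dx /=.
  by rewrite ger0_norm ?powR_ge0// gD.
by apply: filterS fg => x fg Dx; rewrite gD// fg.
Qed.

End in_Lp_integrable.

Section poincare_mean.
Context {d} {R : realType} {X : measurableType d}.
Variables (nu : {measure set X -> \bar R}) (m : R.-pker X ~> X).
Hypothesis hrev : reversible nu m.
Variables (Om : set X) (mOm : measurable Om).
Hypothesis nuOm : (nu Om < +oo)%E.
Hypothesis nuOm0 : (0 < nu Om)%E.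
Variables (p : R) (hp : 1 < p).
Hypothesis hpoinc : poincare nu m p Om.
Local Notation W := (walk_prod nu m).
Local Notation D := (Om `*` Om).

Let p0 : 0 < p. Proof. exact: lt_trans hp. Qed.

Let nuOmE : nu Om = (fine (nu Om))%:E. Proof. by rewrite fineK// ge0_fin_numE. Qed.

Let vol0 : 0 < fine (nu Om). Proof. by rewrite fine_gt0// nuOm0. Qed.

Definition mean (u : X -> R) : R := (\int[nu]_(x in Om) u x) / fine (nu Om).

Lemma Rintegral_cst_Om (c : R) : \int[nu]_(x in Om) c = c * fine (nu Om).
Proof. by rewrite Rintegral_cst. Qed.

Lemma Rintegral_centered u : Lp_fun nu Om p u ->
  \int[nu]_(x in Om) (u x - mean u) = 0.
Proof.
move=> hu; rewrite RintegralB//; last 2 first.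
- exact: Lp_fun_integrable hu.
- exact: integrable_cst_EFin.
by rewrite Rintegral_cst_Om /mean divfK ?subrr// gt_eqF.
Qed.

(** With Z the whole domain, the integral over Z of the centred function
    vanishes, while its differences are those of u. *)
Lemma poincare_centered : exists2 L : R, 0 < L & forall u, Lp_fun nu Om p u ->
  \int[nu]_(x in Om) (`|u x - mean u| `^ p) <=
    L * \int[W]_(z in D) (`|diff u z| `^ p).
Proof.
have [|L L0 hL] := hpoinc vol0; first by rewrite -nuOmE.
exists (L `^ p); first exact: powR_gt0.
move=> u hu; have hw := Lp_funB mOm hp hu (Lp_fun_cst mOm p nuOm (mean u)).
set w := (fun x => u x - mean u) in hw *.
have [mw iw] := hw.
have iW := (Lp_fun_diff hrev mOm hp hu).2.
have wL : in_Lp nu p Om w by apply: (in_LpI mOm p0 mw iw); exact: nearW.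
have := hL w Om wL mOm (@subset_refl _ _).
rewrite -nuOmE => /(_ (lexx _)).
rewrite (integral_EFinE mOm (Lp_fun_integrable mOm hp nuOm hw)) Rintegral_centered//.
rewrite abse0 adde0.
set E := (\int[W]_(z in D) _).
have -> : (\int[nu]_(x in Om) \int[m x]_(y in Om) (`|w y - w x| `^ p)%:E = E%:E)%E.
  have f0 (z : X * X) : (0 <= (`|diff u z| `^ p)%:E)%E by rewrite lee_fin powR_ge0.
  have mf := measurable_int _ iW.
  have := walk_prod_tonelli nu m mOm f0 mf.
  rewrite (integral_EFinE (measurableX mOm mOm) iW) => ->.
  apply: eq_integral => x _; apply: eq_integral => y _.
  by rewrite /diff /w opprB addrA subrK.
have E0 : 0 <= E by apply: Rintegral_ge0 => z _; exact: powR_ge0.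
have LE0 : 0 <= L * E `^ p^-1 by rewrite mulr_ge0 ?powR_ge0// ltW.
rewrite poweR_EFin -EFinM => hN.
have := @gt0_ler_poweR _ p (ltW p0) _ _ _ _ hN.
rewrite (poweR_Lnorm_restrict nu Om p0) (integral_EFinE mOm iw) poweR_EFin lee_fin.
rewrite powRM ?powR_ge0 ?(ltW L0)// -powRrM mulVf ?gt_eqF// powRr1//.
by apply; rewrite in_itv /= leey andbT ?Lnorm_ge0 ?lee_fin.
Qed.

End poincare_mean.

(** * The energy functional and its sublevel sets *)

Section functional.
Context {d} {R : realType} {X : measurableType d}.
Variables (nu : {measure set X -> \bar R}) (m : R.-pker X ~> X).
Hypothesis hrev : reversible nu m.
Variables (Om : set X) (mOm : measurable Om).
Hypothesis nuOm : (nu Om < +oo)%E.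
Hypothesis nuOm0 : (0 < nu Om)%E.
Variables (p : R) (hp : 1 < p).
Hypothesis hpoinc : poincare nu m p Om.
Local Notation q := (p / (p - 1)).
Local Notation W := (walk_prod nu m).
Local Notation D := (Om `*` Om).
Variables (b : X * X -> R -> R) (C c : R) (N : set (X * X)).
Hypothesis hb : regular_flux nu m p c C b N.

Let C0 := rf_C0 hb.
Let c0 := rf_c0 hb.
Let mb := rf_meas hb.
Let cb := rf_cont hb.
Let bmono := rf_mono hb.
Let b0 := rf_zero hb.
Let bgrowth := rf_growth hb.
Let bcoer := rf_coercive hb.
Let mN := rf_measN hb.
Let N0 := rf_null hb.
Let banti := rf_anti hb.

Variable G : X -> R -> set R.
Hypothesis Gmono : forall x, monotone_graph (G x).
Hypothesis G0 : forall x, G x 0 0.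
Hypothesis Gmeas : forall u : X -> R, measurable_fun [set: X] u ->
  measurable_fun [set: X] (fun x => potential (G x) (u x)).
Variable phi : X -> R.
Hypothesis hphi : Lp_fun nu Om q phi.

Implicit Types (u v w V : X -> R) (s t : R).

Let mD : measurable D. Proof. exact: measurableX. Qed.
Let p0 : 0 < p. Proof. exact: lt_trans hp. Qed.
Let q1 : 1 < q.
Proof. by rewrite ltr_pdivlMr ?subr_gt0// mul1r ltrBlDr ltrDl. Qed.

Let intcE s : \int[nu]_(x in Om) s = s * fine (nu Om).
Proof. exact: Rintegral_cst. Qed.

(** The functional contains half of this quantity, since each unordered pair of
    points is counted twice. *)
Definition walk_energy u : R := \int[W]_(z in D) stored b u z.
Definition potential_energy u : \bar R := (\int[nu]_(x in Om) potential (G x) (u x))%E.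
Definition work u : R := \int[nu]_(x in Om) (phi x * u x).

(** The energy is compared with t + work u rather than diminished by work u, and
    its extended part is required to be finite, so that the inequality is
    between real numbers. *)
Definition sublevel t u : Prop := [/\ Lp_fun nu Om p u,
  potential_energy u \is a fin_num & walk_energy u / 2 + fine (potential_energy u) <= t + work u].

Lemma work_integrable u : Lp_fun nu Om p u ->
  nu.-integrable Om (EFin \o (fun x => phi x * u x)).
Proof. by case: hphi => mphi iphi hu; exact: (integrable_mul_Lp_conj mOm hp hu). Qed.

Lemma work_linear s t u v : Lp_fun nu Om p u -> Lp_fun nu Om p v ->
  work (fun x => s * u x + t * v x) = s * work u + t * work v.
Proof.
move=> hu hv; have iu := work_integrable hu; have iv := work_integrable hv.
rewrite /work -!RintegralZl// -RintegralD//; last 2 first.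
- exact: integrableZ_EFin.
- exact: integrableZ_EFin.
by apply: eq_Rintegral => x _; ring.
Qed.

Lemma walk_energy_integrable u : Lp_fun nu Om p u -> W.-integrable D (EFin \o stored b u).
Proof. exact: (stored_integrable hrev mOm nuOm hp hb). Qed.

Lemma walk_energy_midpoint u v : Lp_fun nu Om p u -> Lp_fun nu Om p v ->
  walk_energy (fun x => (u x + v x) / 2) <= walk_energy u / 2 + walk_energy v / 2.
Proof.
move=> hu hv; have iu := walk_energy_integrable hu; have iv := walk_energy_integrable hv.
have hw : Lp_fun nu Om p (fun x => (u x + v x) / 2).
  rewrite (_ : (fun x => _) = (fun x => 2^-1 * (u x + v x))).
    by apply: Lp_funZ => //; exact: Lp_funD.
  by apply/funext => x; rewrite mulrC.
have iw := walk_energy_integrable hw.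
rewrite /walk_energy -!RintegralZr// -RintegralD//; last 2 first.
- by under eq_fun do rewrite mulrC; exact: integrableZ_EFin.
- by under eq_fun do rewrite mulrC; exact: integrableZ_EFin.
apply: le_Rintegral => //.
  apply: integrableD_EFin => //;
    by under eq_fun do rewrite mulrC; exact: integrableZ_EFin.
move=> z _; rewrite /stored (_ : diff _ z = (diff u z + diff v z) / 2).
  exact: primitive_midpoint.
by rewrite /diff; field.
Qed.

Lemma potential_energy_ge0 u : (0 <= potential_energy u)%E.
Proof. by apply: integral_ge0 => x _; exact: potential_ge0. Qed.

Lemma potential_energy_convex t u v : 0 <= t <= 1 ->
  measurable_fun [set: X] u -> measurable_fun [set: X] v ->
  (potential_energy (fun x => t * u x + (1 - t) * v x)%R
    <= t%:E * potential_energy u + (1 - t)%:E * potential_energy v)%E.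
Proof.
move=> /[dup] ht /andP[t0 t1] mU mV; have t1' : 0 <= 1 - t by rewrite subr_ge0.
have mJ w : measurable_fun [set: X] w ->
    measurable_fun Om (fun x => potential (G x) (w x)).
  by move=> mw; apply: measurable_funTS; exact: Gmeas.
have J0 w x : Om x -> (0 <= potential (G x) (w x))%E by move=> _; exact: potential_ge0.
rewrite /potential_energy -ge0_integralZl//; [|exact: mJ|exact: J0].
rewrite -ge0_integralZl//; [|exact: mJ|exact: J0].
rewrite -ge0_integralD//; last 4 first.
- by move=> x Dx; rewrite mule_ge0 ?lee_fin ?J0.
- by apply: measurable_funeM; exact: mJ.
- by move=> x Dx; rewrite mule_ge0 ?lee_fin ?J0.
- by apply: measurable_funeM; exact: mJ.
apply: ge0_le_integral => //.
- by move=> x Dx; exact: potential_ge0.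
- by apply: mJ; apply: measurable_funD; exact: measurable_funM.
- by apply: emeasurable_funD; apply: measurable_funeM; exact: mJ.
- by move=> x _; exact: potential_convex.
Qed.

Lemma sublevel_midpoint t u v : sublevel t u -> sublevel t v ->
  sublevel t (fun x => (u x + v x) / 2).
Proof.
move=> [hu ju ku] [hv jv kv].
have half : 0 <= (2^-1 : R) <= 1 by apply/andP; split; lra.
have E : (fun x => (u x + v x) / 2) = (fun x => 2^-1 * u x + (1 - 2^-1) * v x).
  by apply/funext => x; field.
have hw : Lp_fun nu Om p (fun x => (u x + v x) / 2).
  by rewrite E; apply: Lp_funD => //; exact: Lp_funZ.
have := potential_energy_convex half hu.1 hv.1; rewrite -E => jw.
have wfin : potential_energy (fun x => (u x + v x) / 2) \is a fin_num.
  rewrite ge0_fin_numE ?potential_energy_ge0//; apply: (le_lt_trans jw).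
  by rewrite -(fineK ju) -(fineK jv) -!EFinM -EFinD ltry.
split => //; have := walk_energy_midpoint hu hv.
have := work_linear 2^-1 (1 - 2^-1) hu hv; rewrite -E => ->.
move: jw; rewrite -(fineK ju) -(fineK jv) -(fineK wfin) -!EFinM -EFinD lee_fin.
rewrite !fineK//; lra.
Qed.

Lemma sublevel_le s t u : s <= t -> sublevel s u -> sublevel t u.
Proof.
by move=> st [hu ju ku]; split => //; apply: (le_trans ku); rewrite lerD2r.
Qed.

Lemma sublevel0 : sublevel 0 (fun=> 0).
Proof.
have J0 : potential_energy (fun=> 0) = 0%E.
  by apply: integral0_eq => x _; exact: potential0.
split; first exact: Lp_fun_cst.
  by rewrite J0.
rewrite J0 /= addr0 add0r.
have -> : work (fun=> 0) = 0.
  by rewrite /work; under eq_Rintegral do rewrite mulr0; rewrite intcE mul0r.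
have -> : walk_energy (fun=> 0) = 0.
  rewrite /walk_energy (_ : stored b (fun=> 0) = fun=> 0) ?Rintegral_cst ?mul0r//.
  by apply/funext => z; rewrite /stored /diff subrr primitive0.
by rewrite mul0r.
Qed.

(** The slope V depends on x, but the additive constant does not; as the domain
    has finite measure, bounded slopes belong to L^q. *)
Definition affine_minorant (V : X -> R) (kappa : R) := [/\
  measurable_fun [set: X] V, exists B, forall x, `|V x| <= B &
  forall x r, ((V x * r - kappa)%:E <= potential (G x) r)%E].

Let k := c * 2^-1 `^ p.
Let k0 : 0 < k. Proof. by rewrite mulr_gt0// powR_gt0. Qed.
Let vol := fine (nu Om).

(** The minorant gives int j(x, u) - int phi u >= int (V - phi) u - const.
    Splitting u into its mean and the centred part, the mean contributes the
    mean times int (V - phi), and the contribution of the centred part is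
    absorbed by Young and Poincare. The factor 4 in the hypothesis leaves 2 e
    after halving the walk energy, one of which pays for the absorption. *)
Lemma sublevel_affine_bound V kappa (e : R) : affine_minorant V kappa ->
  0 < e -> (forall u, Lp_fun nu Om p u ->
    4 * e * \int[nu]_(x in Om) (`|u x - mean nu Om u| `^ p)
      <= k * \int[W]_(z in D) (`|diff u z| `^ p)) ->
  exists K, forall t u, sublevel t u ->
    e * \int[nu]_(x in Om) (`|u x - mean nu Om u| `^ p) +
    mean nu Om u * (\int[nu]_(x in Om) V x - \int[nu]_(x in Om) phi x) <= t + K.
Proof.
move=> [mV [B VB] Vj] e0 hL.
have hV : Lp_fun nu Om q V by split => //; exact: Lp_fun_bounded_conj VB.
have hpsi := Lp_funB mOm q1 hV hphi; set psi := (fun x => V x - phi x) in hpsi.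
have [C1 C10 hC1] := young_eps hp e0.
pose Ipsi := \int[nu]_(x in Om) (`|psi x| `^ q).
exists (C1 * Ipsi + kappa * vol) => t u [hu ju ku].
have hw := Lp_funB mOm hp hu (Lp_fun_cst mOm p nuOm (mean nu Om u)).
set w := (fun x => u x - mean nu Om u) in hw *.
set ub := mean nu Om u in w hw *.
have iV : nu.-integrable Om (EFin \o V) by exact: (Lp_fun_integrable mOm q1).
have iphi : nu.-integrable Om (EFin \o phi) by exact: (Lp_fun_integrable mOm q1).
have ipsi : nu.-integrable Om (EFin \o psi) by exact: (Lp_fun_integrable mOm q1).
have iVu : nu.-integrable Om (EFin \o (fun x => V x * u x)).
  by case: hV => ? ?; exact: (integrable_mul_Lp_conj mOm hp hu).
have icst := integrable_cst_EFin mOm nuOm.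
have h1 : \int[nu]_(x in Om) (V x * u x) - kappa * vol <= fine (potential_energy u).
  rewrite -intcE -RintegralB// -lee_fin (fineK ju).
  rewrite -integral_EFinE//; last exact: integrableB_EFin.
  apply: le_integral => //; first exact: integrableB_EFin.
  apply/integrableP; split; first by apply: measurable_funTS; apply: Gmeas; case: hu.
  under eq_integral do rewrite gee0_abs ?potential_ge0//.
  by move: ju; rewrite fin_numElt => /andP[].
have h2 : \int[nu]_(x in Om) (V x * u x) - work u >=
    ub * (\int[nu]_(x in Om) V x - \int[nu]_(x in Om) phi x)
    - e * \int[nu]_(x in Om) (`|w x| `^ p) - C1 * Ipsi.
  have ip := work_integrable hu.
  have iw := hw.2; have iq := hpsi.2.
  have iVp := integrableB_EFin mOm iV iphi.
  have i1 := integrableZ_EFin mOm ub iVp.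
  have i2 := integrableZ_EFin mOm e iw.
  have i3 := integrableZ_EFin mOm C1 iq.
  have i12 := integrableB_EFin mOm i1 i2.
  have i123 := integrableB_EFin mOm i12 i3.
  have i4 := integrableB_EFin mOm iVu ip.
  rewrite -!RintegralB// /Ipsi -!RintegralZl// -!RintegralB//.
  apply: le_Rintegral => //.
  move=> x _; have := hC1 _ _ (normr_ge0 (w x)) (normr_ge0 (psi x)).
  rewrite -normrM; have := ler_norm (- (w x * psi x)); rewrite normrN => n1 n2.
  have -> : V x * u x - phi x * u x = w x * psi x + ub * (V x - phi x).
    by rewrite /w /psi; ring.
  lra.
have h3 : k * \int[W]_(z in D) (`|diff u z| `^ p) <= walk_energy u.
  rewrite -lee_fin -integral_EFinE; [|exact: mD|exact: walk_energy_integrable].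
  exact: (stored_ge hrev mOm hp hb hu).
have := hL _ hu; lra.
Qed.

Variables (V1 V2 : X -> R) (k1 k2 : R).
Hypotheses (hV1 : affine_minorant V1 k1) (hV2 : affine_minorant V2 k2).
Hypothesis V1phi : \int[nu]_(x in Om) phi x < \int[nu]_(x in Om) V1 x.
Hypothesis V2phi : \int[nu]_(x in Om) V2 x < \int[nu]_(x in Om) phi x.

(** Of the two minorants, the one with the larger slopes controls positive means
    and the one with the smaller slopes controls negative means. *)
Lemma sublevel_coercive : exists e delta K, [/\ 0 < e, 0 < delta &
  forall t u, sublevel t u ->
    e * \int[nu]_(x in Om) (`|u x - mean nu Om u| `^ p) +
    delta * `|mean nu Om u| <= t + K].
Proof.
have [L L0 hL] := poincare_centered hrev mOm nuOm nuOm0 hp hpoinc.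
pose e := k / (4 * L); have e0 : 0 < e by rewrite divr_gt0// mulr_gt0.
have hL' u : Lp_fun nu Om p u ->
    4 * e * \int[nu]_(x in Om) (`|u x - mean nu Om u| `^ p)
      <= k * \int[W]_(z in D) (`|diff u z| `^ p).
  move=> /hL h; have -> : 4 * e = k / L by rewrite /e; field; rewrite gt_eqF.
  have kL : 0 <= k / L by rewrite divr_ge0 ?ltW.
  apply: (le_trans (ler_wpM2l kL h)); rewrite le_eqVlt; apply/orP; left.
  by apply/eqP; field; rewrite gt_eqF.
have [K1 hK1] := sublevel_affine_bound hV1 e0 hL'.
have [K2 hK2] := sublevel_affine_bound hV2 e0 hL'.
have P1F := V1phi; have FP2 := V2phi.
set P1 := \int[nu]_(x in Om) V1 x in P1F hK1.
set P2 := \int[nu]_(x in Om) V2 x in FP2 hK2.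
set F := \int[nu]_(x in Om) phi x in P1F FP2 hK1 hK2.
exists e, (Num.min (P1 - F) (F - P2)), (Num.max K1 K2); split => //.
  by rewrite lt_min !subr_gt0 P1F FP2.
move=> t u hu; have := hK1 _ _ hu; have := hK2 _ _ hu.
have mK1 : K1 <= Num.max K1 K2 by rewrite le_max lexx.
have mK2 : K2 <= Num.max K1 K2 by rewrite le_max lexx orbT.
have md1 : Num.min (P1 - F) (F - P2) <= P1 - F by rewrite ge_min lexx.
have md2 : Num.min (P1 - F) (F - P2) <= F - P2 by rewrite ge_min lexx orbT.
move: (Num.max _ _) mK1 mK2 (Num.min _ _) md1 md2 => K mK1 mK2 dl md1 md2.
move: (mean _ _ _) (\int[nu]_(x in Om) _) => ub I h2 h1.
have [ub0|/ltW ub0] := leP 0 ub.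
  by rewrite ger0_norm//; have := ler_wpM2r ub0 md1; lra.
by rewrite ler0_norm//; have := ler_wnM2r ub0 md2; lra.
Qed.

Lemma sublevel_lower : exists K, forall t u, sublevel t u -> - K <= t.
Proof.
have [e [dl [K [e0 dl0 h]]]] := sublevel_coercive; exists K => t u /h.
have : 0 <= \int[nu]_(x in Om) (`|u x - mean nu Om u| `^ p).
  by apply: Rintegral_ge0 => x _; exact: powR_ge0.
have := normr_ge0 (mean nu Om u); nra.
Qed.

Lemma sublevel_Lp_bound t : exists M, forall u, sublevel t u ->
  \int[nu]_(x in Om) (`|u x| `^ p) <= M.
Proof.
have [e [dl [K [e0 dl0 h]]]] := sublevel_coercive.
exists (2 `^ p * ((t + K) / e + ((t + K) / dl) `^ p * vol)) => u hu.
have [hup _ _] := hu.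
have := h _ _ hu; set w := (fun x => u x - mean nu Om u).
have hw : Lp_fun nu Om p w by exact: Lp_funB (Lp_fun_cst _ _ _ _).
set ub := mean nu Om u in w hw *; set I := \int[nu]_(x in Om) (`|w x| `^ p) => hI.
have I0 : 0 <= I by apply: Rintegral_ge0 => x _; exact: powR_ge0.
have n0 := normr_ge0 ub.
have I1 : I <= (t + K) / e by rewrite ler_pdivlMr//; nra.
have ub1 : `|ub| <= (t + K) / dl by rewrite ler_pdivlMr//; nra.
have iub := integrable_cst_EFin mOm nuOm (`|ub| `^ p).
have isum := integrableD_EFin mOm hw.2 iub.
apply: (@le_trans _ _ (2 `^ p * (I + `|ub| `^ p * vol))); last first.
  rewrite ler_wpM2l ?powR_ge0// lerD// ler_wpM2r//.
    by rewrite fine_ge0.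
  by rewrite ge0_ler_powR ?nnegrE ?(ltW p0)//; exact: le_trans ub1.
rewrite -intcE -RintegralD//; last exact: hw.2.
rewrite -RintegralZl//; apply: le_Rintegral => //.
- exact: hup.2.
- exact: integrableZ_EFin.
- move=> x _; have := powR_normD_le hp (w x) ub.
  by rewrite /w subrK.
Qed.

(** Fatou applies to nonnegative integrands, and phi u has no sign. Adding e
    |u|^p + C |phi|^q makes the integrand nonnegative by Young; the sublevel
    sets are bounded in L^p, so this costs at most a multiple of e, which then
    tends to 0. *)
Lemma sublevel_closed t u (u_ : nat -> X -> R) :
  (forall n, sublevel (t + n.+1%:R^-1) (u_ n)) -> measurable_fun [set: X] u ->
  {ae nu, forall x, Om x -> u_ ^~ x @ \oo --> u x} -> sublevel t u.
Proof.
move=> hu_ mU uu.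
have inv1 n : n.+1%:R^-1 <= 1 :> R by rewrite invf_le1 ?ler1n.
have hu1 n : sublevel (t + 1) (u_ n).
  by apply: sublevel_le (hu_ n); rewrite lerD2l.
have [M0 hM0] := sublevel_Lp_bound (t + 1).
pose M := Num.max M0 0; have M_ge0 : 0 <= M by rewrite le_max lexx orbT.
have hM n : \int[nu]_(x in Om) (`|u_ n x| `^ p) <= M.
  by apply: (le_trans (hM0 _ (hu1 n))); rewrite le_max lexx.
have Lu_ n : Lp_fun nu Om p (u_ n) by case: (hu_ n).
have mu_ n : measurable_fun [set: X] (u_ n) by case: (Lu_ n).
have powc (v : R^nat) (l : R) : v @ \oo --> l ->
    `|v n| `^ p @[n --> \oo] --> `|l| `^ p.
  by move=> vl; apply: (cvg_comp _ _ vl (@continuous_powR_norm _ p hp l)).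
have Lu : Lp_fun nu Om p u.
  split=> //; have mp := measurable_powR_norm p mU.
  apply: ge0_integrable_EFin => //.
  apply: (@le_lt_trans _ _ (limn_einf (fun n => \int[nu]_(x in Om) (`|u_ n x| `^ p)%:E)%E)).
    apply: fatou_ae => //.
    - move=> n; apply/measurable_EFinP; apply: measurable_funTS.
      exact: measurable_powR_norm.
    - by apply/measurable_EFinP; exact: measurable_funTS.
    - apply: filterS uu => x + Dx => /(_ Dx) /powc; exact: limn_einf_cvg_fin.
  apply: (@le_lt_trans _ _ M%:E); last exact: ltry.
  rewrite limn_einf_lim; apply: lime_le; first exact: is_cvg_einfs.
  apply: nearW => n; apply: ge_ereal_inf.
  exists (\int[nu]_(x in Om) (`|u_ n x| `^ p)%:E)%E; first by exists n => /=.
  by rewrite integral_EFinE//; [rewrite lee_fin|exact: (Lu_ n).2].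
have SA : ((walk_energy u)%:E <= limn_einf (fun n => (walk_energy (u_ n))%:E))%E.
  rewrite /walk_energy -integral_EFinE//; last exact: walk_energy_integrable.
  under [X in limn_einf X]eq_fun => n.
    rewrite -integral_EFinE//; last exact: walk_energy_integrable.
    over.
  apply: fatou_ae => //.
  - move=> n; apply/measurable_EFinP; apply: measurable_funTS; exact: (measurable_stored hb).
  - apply/measurable_EFinP; apply: measurable_funTS; exact: (measurable_stored hb).
  - by move=> n z _; rewrite lee_fin; exact: primitive_ge0.
  - by move=> z _; rewrite lee_fin; exact: primitive_ge0.
  - have := @ae_walk_prod _ _ _ nu m hrev (fun x => Om x -> u_ ^~ x @ \oo --> u x) uu.
    apply: filterS => z [h1 h2] [D1 D2].
    apply: primitive_le_liminf => //.
    by apply: cvgB; [exact: h2|exact: h1].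
have key e : 0 < e -> (((walk_energy u) / 2)%:E + potential_energy u <= (t + work u + e * M)%:E)%E.
  move=> e0; have [C1 C10 hC1] := young_eps hp e0.
  pose rest (v : X -> R) x := e * `|v x| `^ p + C1 * `|phi x| `^ q - phi x * v x.
  have rest0 v x : 0 <= rest v x.
    rewrite /rest subr_ge0 [phi x * _]mulrC.
    by apply: (le_trans (ler_norm _)); rewrite normrM hC1.
  have irest v : Lp_fun nu Om p v -> nu.-integrable Om (EFin \o rest v).
    move=> hv; apply: integrableB_EFin => //; last exact: work_integrable.
    apply: integrableD_EFin => //; apply: integrableZ_EFin => //; first exact: hv.2.
    exact: hphi.2.
  pose Iphi := \int[nu]_(x in Om) (`|phi x| `^ q).
  have Irest v : Lp_fun nu Om p v -> \int[nu]_(x in Om) rest v x =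
      e * \int[nu]_(x in Om) (`|v x| `^ p) + C1 * Iphi - work v.
    move=> hv; have iv := hv.2; have ip := hphi.2; have iw := work_integrable hv.
    have i1 := integrableZ_EFin mOm e iv; have i2 := integrableZ_EFin mOm C1 ip.
    have i3 := integrableD_EFin mOm i1 i2.
    by rewrite /rest RintegralB// RintegralD// !RintegralZl.
  pose h (v : X -> R) x := (potential (G x) (v x) + (rest v x)%:E)%E.
  have mP v : Lp_fun nu Om p v -> measurable_fun Om (fun x => potential (G x) (v x)).
    by move=> [mv _]; apply: measurable_funTS; exact: Gmeas.
  have mh v : Lp_fun nu Om p v -> measurable_fun Om (h v).
    by move=> hv; apply: emeasurable_funD; [exact: mP|case/integrableP: (irest v hv)].
  have h0 v x : (0 <= h v x)%E by rewrite adde_ge0 ?potential_ge0// lee_fin.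
  have Ih v : Lp_fun nu Om p v -> (\int[nu]_(x in Om) h v x = potential_energy v +
      (e * \int[nu]_(x in Om) (`|v x| `^ p) + C1 * Iphi - work v)%:E)%E.
    move=> hv; rewrite ge0_integralD//; last 4 first.
    - by move=> x _; exact: potential_ge0.
    - exact: mP.
    - by move=> x _; rewrite lee_fin.
    - by case/integrableP: (irest v hv).
    by rewrite integral_EFinE ?Irest//; exact: irest.
  have SH : (\int[nu]_(x in Om) h u x <=
      limn_einf (fun n => \int[nu]_(x in Om) h (u_ n) x))%E.
    apply: fatou_ae => //; [by move=> n; exact: mh|exact: mh|].
    apply: filterS uu => x + Dx => /(_ Dx) ux; apply: limn_einf_addl.
    - exact: potential_ge0.
    - exact: potential_le_liminf.
    - apply: cvgB; last by apply: cvgMr.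
      by apply: cvgD; [apply: cvgMr; exact: powc|exact: cvg_cst].
  have : (((walk_energy u) / 2)%:E + \int[nu]_(x in Om) h u x
      <= (t + e * M + C1 * Iphi)%:E)%E.
    apply: ge0_adde_le_EFin.
    - rewrite lee_fin divr_ge0//; apply: Rintegral_ge0 => z _; exact: primitive_ge0.
    - by apply: integral_ge0.
    move=> r s; rewrite lte_fin => rA sH.
    have rA' : ((2 * r)%:E < (walk_energy u)%:E)%E by rewrite lte_fin; lra.
    have nA := lt_limn_einf (lt_le_trans rA' SA).
    have nH := lt_limn_einf (lt_le_trans sH SH).
    apply/ler_addgt0Pr => g g0; near \oo => n.
    have : 2 * r <= walk_energy (u_ n) by rewrite -lee_fin; near: n.
    have : (s%:E <= \int[nu]_(x in Om) h (u_ n) x)%E by near: n.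
    have ng : n.+1%:R^-1 <= g.
      by apply: ltW; near: n; exact: (near_infty_natSinv_lt (PosNum g0)).
    have [_ jn kn] := hu_ n.
    rewrite Ih// -(fineK jn) -EFinD lee_fin.
    have := ler_wpM2l (ltW e0) (hM n).
    move: kn ng; move: (n.+1%:R^-1) => i kn ng.
    move: (e * \int[nu]_(x in Om) _) (e * M) (C1 * Iphi) => a1 a2 a3; lra.
  rewrite Ih// addeA -leeBrDr// -EFinB => /le_trans; apply; rewrite lee_fin.
  have : 0 <= e * \int[nu]_(x in Om) (`|u x| `^ p).
    by rewrite mulr_ge0 ?(ltW e0)//; apply: Rintegral_ge0 => x _; exact: powR_ge0.
  move: (e * \int[nu]_(x in Om) _) (e * M) (C1 * Iphi) => a1 a2 a3; lra.
have Ju : potential_energy u \is a fin_num.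
  rewrite ge0_fin_numE ?potential_energy_ge0//; have := key _ ltr01.
  by rewrite addeC -leeBrDr// -EFinB => /le_lt_trans; apply; exact: ltry.
split=> //; apply/ler_addgt0Pr => g g0.
have M1 : 0 < M + 1 by rewrite ltr_wpDl.
have := key (g / (M + 1)) (divr_gt0 g0 M1).
rewrite -(fineK Ju) -EFinD lee_fin => /le_trans; apply; rewrite lerD2l.
by rewrite mulrAC ler_pdivrMr// ler_pM2l// lerDl.
Unshelve. all: by end_near. Qed.

(** With t the infimum of the levels of nonempty sublevel sets, the sublevel
    sets at t + 1/(n + 1) decrease and a selection of them that converges almost
    everywhere has its limit in the sublevel set at t. *)
Lemma sublevel_min : exists t u, sublevel t u /\
  forall s v, sublevel s v -> t <= s.
Proof.
have [K hK] := sublevel_lower.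
pose S := [set t | exists u, sublevel t u].
have S0 : S !=set0 by exists 0, (fun=> 0); exact: sublevel0.
have lS : has_lbound S by exists (- K) => t [u] /hK.
pose t := inf S.
have St s : t < s -> exists u, sublevel s u.
  move=> ts; have s0 : 0 < s - t by rewrite subr_gt0.
  have [r [u hu]] := inf_adherent s0 (conj S0 lS).
  by rewrite addrC subrK => /ltW rs; exists u; exact: sublevel_le hu.
have n0 n : 0 < n.+1%:R^-1 :> R by rewrite invr_gt0.
pose Kn n := [set u | sublevel (t + n.+1%:R^-1) u].
have [M hM] := sublevel_Lp_bound (t + 1).
have [u_ [u [Ku mU uu]]] : exists (u_ : nat -> X -> R) (u : X -> R),
    [/\ forall n, Kn n (u_ n), measurable_fun [set: X] u &
      {ae nu, forall x, Om x -> u_ ^~ x @ \oo --> u x}].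
  apply: (@nested_convex_ae_cvg _ _ _ nu Om mOm nuOm Kn (vol + M)).
  - by move=> n; have [|u hu] := St (t + n.+1%:R^-1); [rewrite ltrDl|exists u].
  - move=> i j ij v; apply: sublevel_le; rewrite lerD2l lef_pV2 ?posrE//.
    by rewrite ler_nat.
  - by move=> v [[]].
  - by move=> n v w; exact: sublevel_midpoint.
  - move=> v hv; have [Lv _ _] := hv.
    have iv := Lp_fun_integrable mOm hp nuOm Lv.
    have i1 := integrable_cst_EFin mOm nuOm 1.
    have /hM hMv : sublevel (t + 1) v by move: hv; rewrite /Kn /= invr1.
    have iav := integrable_norm iv.
    rewrite integral_EFinE// lee_fin.
    apply: (@le_trans _ _ (\int[nu]_(x in Om) (1 + `|v x| `^ p))).
      apply: le_Rintegral => //; first exact: integrableD_EFin i1 Lv.2.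
      move=> x _; have := @powR_le1D _ p `|v x| 1 ler01 (ltW hp) (normr_ge0 _).
      by rewrite powRr1.
    rewrite RintegralD//; last exact: Lv.2.
    by rewrite intcE mul1r lerD2l.
exists t, u; split; first exact: sublevel_closed Ku mU uu.
by move=> s v hv; apply: ge_inf => //; exists v.
Qed.

Lemma diff_linear s t u v z :
  diff (fun x => s * u x + t * v x) z = s * diff u z + t * diff v z.
Proof. by rewrite /diff; ring. Qed.

(** Comparing u with (1 - s) u + s w, where s = 1/(n + 1), and dividing by s.
    Convexity bounds the increments: that of the walk energy by the flux at the
    comparison function, which passes to the limit by dominated convergence. *)
Lemma variational_inequality t u w : sublevel t u ->
  (forall s v, sublevel s v -> t <= s) ->
  Lp_fun nu Om p w -> potential_energy w \is a fin_num ->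
  work w - work u <= (\int[W]_(z in D) (flux b u z * (diff w z - diff u z))) / 2
    + (fine (potential_energy w) - fine (potential_energy u)).
Proof.
move=> [hu ju ku] tmin hw jw.
have hU := Lp_fun_diff hrev mOm hp hu; have hW := Lp_fun_diff hrev mOm hp hw.
have hH := Lp_funB mD hp hW hU.
set H := (fun z => diff w z - diff u z) in hH *.
pose T n : R := n.+1%:R^-1.
have T0 n : 0 < T n by rewrite invr_gt0.
have T1 n : T n <= 1 by rewrite invf_le1 ?ler1n.
pose v n x := T n * w x + (1 - T n) * u x.
have hv n : Lp_fun nu Om p (v n) by apply: Lp_funD => //; exact: Lp_funZ.
have dv n z : diff (v n) z = T n * diff w z + (1 - T n) * diff u z by exact: diff_linear.
have mflux n : measurable_fun [set: X * X] (fun z => flux b (v n) z * H z).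
  by apply: measurable_funM; [apply: (measurable_flux hb); exact: (hv n).1|exact: hH.1].
have iflux n : W.-integrable D (EFin \o (fun z => flux b (v n) z * H z)).
  exact: (flux_mul_integrable hrev mOm nuOm hp hb).
have step n : work w - work u <= (\int[W]_(z in D) (flux b (v n) z * H z)) / 2
    + (fine (potential_energy w) - fine (potential_energy u)).
  have hT : 0 <= T n <= 1 by rewrite ltW ?T1.
  have jv := potential_energy_convex hT hw.1 hu.1; rewrite -/(v n) in jv.
  have jfin : potential_energy (v n) \is a fin_num.
    rewrite ge0_fin_numE ?potential_energy_ge0//; apply: (le_lt_trans jv).
    by rewrite -(fineK jw) -(fineK ju) -!EFinM -EFinD ltry.
  move: jv; rewrite -(fineK jw) -(fineK ju) -(fineK jfin) -!EFinM -EFinD lee_fin => jv.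
  have := tmin (walk_energy (v n) / 2 + fine (potential_energy (v n)) - work (v n)) (v n).
  rewrite /sublevel subrK => /(_ (And3 (hv n) jfin (lexx _))).
  rewrite [work (v n)]work_linear// => tle.
  have dA : walk_energy (v n) - walk_energy u <= T n * \int[W]_(z in D) (flux b (v n) z * H z).
    have iv := walk_energy_integrable (hv n); have iu := walk_energy_integrable hu.
    have il := integrableZ_EFin mD (T n) (iflux n).
    rewrite /walk_energy -RintegralB// -RintegralZl//; apply: le_Rintegral => //.
      exact: integrableB_EFin.
    move=> z _; have := primitive_subgradient bmono b0 z (diff (v n) z) (diff u z).
    rewrite -/(flux b (v n) z) -/(stored b (v n) z) -/(stored b u z).
    have -> : diff u z - diff (v n) z = - (T n * H z) by rewrite dv /H; ring.
    rewrite mulrN mulrCA => h; rewrite lerBlDr -lerBlDl.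
    exact: h.
  rewrite -(ler_pM2l (T0 n)) /=; move: dA tle jv ku (T0 n).
  move: (\int[W]_(z in D) _) (walk_energy (v n)) (walk_energy u) (work w) (work u).
  move: (fine (potential_energy w)) (fine (potential_energy u)) (fine (potential_energy (v n))) (T n).
  by move=> a1 a2 a3 a4 a5 a6 a7 a8 a9; lra.
have lim : \int[W]_(z in D) (flux b (v n) z * H z) @[n --> \oo] -->
    \int[W]_(z in D) (flux b u z * H z).
  (* The bound for all n at once comes from |(1 - s) diff u + s diff w| <= |diff
     w| + |diff u| and the growth of the flux. *)
  pose g z := (2 * C) `^ q * (1 + 2 `^ p * (`|diff w z| `^ p + `|diff u z| `^ p)) + `|H z| `^ p.
  have i1 := integrable_cst_EFin mD (walk_prod_finite m mOm nuOm) 1.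
  have ig : W.-integrable D (EFin \o g).
    apply: integrableD_EFin => //; last exact: hH.2.
    apply: integrableZ_EFin => //; apply: integrableD_EFin => //.
    by apply: integrableZ_EFin => //; apply: integrableD_EFin => //; [exact: hW.2|exact: hU.2].
  have [|||||_ _] := @dominated_convergence _ _ _ W D mD
      (fun n z => (flux b (v n) z * H z)%:E) (fun z => (flux b u z * H z)%:E) (EFin \o g).
  - by move=> n; apply/measurable_EFinP; exact: measurable_funTS.
  - apply/measurable_EFinP; apply: measurable_funTS; apply: measurable_funM => //.
      by apply: (measurable_flux hb); exact: hu.1.
    exact: hH.1.
  - apply: nearW => z Dz; apply: cvg_EFin; first exact: nearW.
    have hd : diff (v n) z @[n --> \oo] --> diff u z.
      rewrite (_ : (fun n => diff (v n) z) = (fun n => H z * T n + diff u z)).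
        rewrite -[X in _ --> X]add0r -[X in _ --> X + _](mulr0 (H z)).
        by apply: cvgD; [apply: cvgMl_tmp; exact: cvg_harmonic|exact: cvg_cst].
      by apply/funext => n; rewrite dv /H; ring.
    have hfl : flux b (v n) z @[n --> \oo] --> flux b u z.
      exact: (cvg_comp _ _ hd (@cb z (diff u z))).
    exact: (cvgMr_tmp hfl).
  - exact: ig.
  - apply: nearW => z n Dz; rewrite lee_fin normrM mulrC.
    apply: (le_trans (young hp _ _)) => //; rewrite /g addrC lerD2r.
    apply: (le_trans (growth_powR hp C0 (bgrowth _ _))).
    rewrite ler_wpM2l ?powR_ge0// lerD2l.
    apply: le_trans (powRD_le (ltW p0) (normr_ge0 (diff w z)) (normr_ge0 (diff u z))).
    apply: ge0_ler_powR; rewrite ?(ltW p0)// ?nnegrE ?addr_ge0//.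
    rewrite dv (le_trans (ler_normD _ _))// !normrM lerD//.
      by rewrite ler_piMl// ger0_norm ?T1// ltW.
    by rewrite ler_piMl// ger0_norm ?subr_ge0// gerBl ltW.
  have ifl := flux_mul_integrable hrev mOm nuOm hp hb hu hH.
  by rewrite (integral_EFinE mD ifl) => /fine_cvgP[_].
set cc := fine (potential_energy w) - fine (potential_energy u) in step *.
have lim2 : (\int[W]_(z in D) (flux b (v n) z * H z)) / 2 + cc @[n --> \oo] -->
    (\int[W]_(z in D) (flux b u z * H z)) / 2 + cc.
  by apply: cvgD; [exact: (cvgMr_tmp lim)|exact: cvg_cst].
by apply: (cvgr_to_ge lim2); exact: nearW.
Qed.

Section net_flux.
Variable u : X -> R.
Hypothesis hu : Lp_fun nu Om p u.

Let fl := flux b u.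
Let mfl : measurable_fun [set: X * X] fl.
Proof. by apply: (measurable_flux hb); case: hu. Qed.

Let mflx x : measurable_fun [set: X] (fun y => fl (x, y)).
Proof. exact: measurableT_comp. Qed.

Let iflq : W.-integrable D (EFin \o (fun z => `|fl z| `^ q)).
Proof. exact: (flux_conj_integrable hrev mOm nuOm hp hb hu). Qed.

Let ifl : W.-integrable D (EFin \o fl).
Proof.
by apply: (Lp_fun_integrable mD q1 (walk_prod_finite m mOm nuOm)); split.
Qed.

Let inner x : \bar R := (\int[m x]_(y in Om) (fl (x, y))%:E)%E.

(** Set to 0 outside the domain, so as to be measurable on the whole space. *)
Definition netflux : X -> R := fine \o (inner \_ Om).

Lemma measurable_netflux : measurable_fun [set: X] netflux.
Proof.
apply: measurableT_comp => //; apply: (measurable_restrictT _ mOm).1.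
have [/integrableP[+ _] _] := walk_prod_fubini mOm ifl; exact.
Qed.

Let ae_section : {ae nu, forall x, Om x -> Lp_fun (m x) Om q (fun y => fl (x, y))}.
Proof.
have [i1 _] := walk_prod_fubini mOm iflq.
apply: filterS (integrable_ae mOm i1) => x + Ox => /(_ Ox) fin1; split => //.
apply: ge0_integrable_EFin => //.
  by apply: measurable_powR_norm; exact: mflx.
by move: fin1; rewrite fin_numElt => /andP[].
Qed.

Let mxOm x : (m x Om < +oo)%E.
Proof. by apply: (le_lt_trans (kernel_le1 m mOm x)); rewrite ltry. Qed.

Lemma netfluxE : {ae nu, forall x, Om x ->
  (\int[m x]_(y in Om) (flux b u (x, y))%:E = (netflux x)%:E)%E}.
Proof.
apply: filterS ae_section => x + Ox => /(_ Ox) hx.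
have ix := Lp_fun_integrable mOm q1 (mxOm x) hx.
by rewrite /netflux /= patchE mem_set// /inner fineK// integrable_fin_num.
Qed.

(** Each m x has mass at most 1, so integration over the second variable maps
    L^q of the product to L^q. *)
Lemma Lp_fun_netflux : Lp_fun nu Om q netflux.
Proof.
have mn := measurable_netflux; split => //.
have mnp := measurable_powR_norm q mn.
have [i1 _] := walk_prod_fubini mOm iflq.
apply: ge0_integrable_EFin => //.
apply: le_lt_trans (integrable_lty mOm (integrableZl mOm (2 `^ q) i1)).
apply: ae_ge0_le_integral => //.
- by apply/measurable_EFinP; exact: measurable_funTS.
- move=> x _; rewrite mule_ge0// ?lee_fin ?powR_ge0//.
  by apply: integral_ge0 => y _; rewrite lee_fin powR_ge0.
- by case/integrableP: (integrableZl mOm (2 `^ q) i1).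
- apply: filterS ae_section => x + Ox => /(_ Ox) hx.
  rewrite /= (integral_EFinE mOm hx.2) -EFinM lee_fin.
  have := powR_norm_integral_le mOm q1 (kernel_le1 m mOm x) hx.
  by rewrite /netflux /= patchE mem_set.
Qed.

(** Integration by parts: exchanging the variables preserves the measure by
    reversibility and changes the sign of the flux by antisymmetry, so the two
    terms of the difference contribute equally. *)
Lemma flux_diff_integral h : Lp_fun nu Om p h ->
  \int[W]_(z in D) (flux b u z * diff h z) =
  - (2 * \int[nu]_(x in Om) (netflux x * h x)).
Proof.
move=> hh; have [mh ih] := hh; have mhp := measurable_powR_norm p mh.
have h1 : Lp_fun W D p (fun z => h z.1).
  by split; [exact: measurableT_comp|exact: (integrable_walk_fst m mOm mhp)].
have h2 : Lp_fun W D p (fun z => h z.2).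
  by split; [exact: measurableT_comp|exact: (integrable_walk_snd hrev mOm mhp)].
have i1 := flux_mul_integrable hrev mOm nuOm hp hb hu h1.
have i2 := flux_mul_integrable hrev mOm nuOm hp hb hu h2.
have E1 : \int[W]_(z in D) (flux b u z * h z.1) = \int[nu]_(x in Om) (netflux x * h x).
  have [j1 e1] := walk_prod_fubini mOm i1.
  rewrite /Rintegral; congr fine; rewrite [LHS]e1.
  have inh := integrable_mul_Lp_conj mOm hp hh measurable_netflux Lp_fun_netflux.2.
  apply: ae_eq_integral => //.
  - by case/integrableP : j1.
  - by case/integrableP : inh.
  apply: filterS ae_section => x + Ox => /(_ Ox) hx.
  have ix := Lp_fun_integrable mOm q1 (mxOm x) hx.
  rewrite /= (_ : (fun y => _) = (fun y => (fl (x, y))%:E * (h x)%:E)%E)//.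
  rewrite integralZr// -/(inner x) /netflux /= patchE mem_set//.
  by rewrite EFinM fineK// integrable_fin_num.
have E2 : \int[W]_(z in D) (flux b u z * h z.2) = - \int[nu]_(x in Om) (netflux x * h x).
  rewrite -E1 /Rintegral.
  rewrite -(walk_prod_integral_flip mOm hrev (f := fun z => (flux b u z * h z.2)%:E)).
    rewrite (_ : (fun z => _) = (fun z => - (flux b u z * h z.1)%:E)%E).
      rewrite integralN ?fineN//.
      by apply: integrable_add_def.
    apply/funext => z; rewrite -EFinN -mulNr; congr (_ * _)%:E.
    by rewrite /flux [in RHS]banti opprK; congr (b _ _); rewrite /diff /= opprB.
  by case/integrableP : i2.
under eq_Rintegral do rewrite /diff mulrBr.
by rewrite RintegralB// E1 E2; ring.
Qed.

End net_flux.

(** Integration by parts turns the variational inequality into the statement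
    that phi plus the net flux is a subgradient of the potential energy at u. *)
Lemma euler_lagrange t u w : sublevel t u ->
  (forall s v, sublevel s v -> t <= s) ->
  Lp_fun nu Om p w -> potential_energy w \is a fin_num ->
  \int[nu]_(x in Om) ((phi x + netflux u x) * (w x - u x)) <=
    fine (potential_energy w) - fine (potential_energy u).
Proof.
move=> hu tmin hw jw; have := variational_inequality hu tmin hw jw.
have Lu : Lp_fun nu Om p u by case: hu.
have hh := Lp_funB mOm hp hw Lu.
have -> : \int[W]_(z in D) (flux b u z * (diff w z - diff u z)) =
    \int[W]_(z in D) (flux b u z * diff (fun x => w x - u x) z).
  by apply: eq_Rintegral => z _; rewrite /diff; ring.
rewrite flux_diff_integral//.
have iw := work_integrable hw; have iu := work_integrable Lu.
have inh := integrable_mul_Lp_conj mOm hp hh (measurable_netflux Lu) (Lp_fun_netflux Lu).2.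
have -> : \int[nu]_(x in Om) ((phi x + netflux u x) * (w x - u x)) =
    (work w - work u) + \int[nu]_(x in Om) (netflux u x * (w x - u x)).
  have iwu := integrableB_EFin mOm iw iu.
  rewrite /work -RintegralB// -RintegralD//.
  by apply: eq_Rintegral => x _; ring.
lra.
Qed.

(** Let w equal r on the subset E where the product is negative, and u
    elsewhere. As s is a subgradient of the potential at r, the Euler-Lagrange
    inequality for w makes the integral over E of the negated product
    nonpositive, so E is null. *)
Lemma minimiser_monotone_test t u (Om' : set X) (r s : R) : sublevel t u ->
  (forall s v, sublevel s v -> t <= s) ->
  measurable Om' -> Om' `<=` Om -> (forall x, Om' x -> G x r s) ->
  {ae nu, forall x, Om' x -> 0 <= (phi x + netflux u x - s) * (u x - r)}.
Proof.
move=> hs tmin mOm' OmOm' Grs; have [Lu ju _] := hs; have [mu_ _] := Lu.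
have [mphi _] := hphi; have mnf := measurable_netflux Lu.
pose f x := phi x + netflux u x.
have mf : measurable_fun [set: X] f by exact: measurable_funD.
have Lf : Lp_fun nu Om q f by exact: (Lp_funD mOm q1 hphi (Lp_fun_netflux Lu)).
pose kt x := (f x - s) * (r - u x).
have mkt : measurable_fun [set: X] kt.
  by apply: measurable_funM; exact: measurable_funB.
pose E := Om' `&` [set x | 0 < kt x].
have mE : measurable E.
  apply: measurableI => //; rewrite -[X in measurable X]setTI.
  rewrite (_ : [set x | _] = kt @^-1` `]0, +oo[%classic); first exact: mkt.
  by apply/seteqP; split => x /=; rewrite in_itv/= andbT.
pose w x := if x \in E then r else u x.
have Lw : Lp_fun nu Om p w by exact: Lp_fun_if.
pose g x := if x \in E then s * (u x - r) else 0.
have Lur := Lp_funB mOm hp Lu (Lp_fun_cst mOm p nuOm r).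
have mg : measurable_fun [set: X] g.
  apply: measurable_fun_ifT => //; first exact: measurable_fun_in.
  by apply: measurable_funM => //; exact: Lur.1.
have ig : nu.-integrable Om (EFin \o g).
  have iur := integrable_norm (Lp_fun_integrable mOm hp nuOm Lur).
  apply: le_integrable_EFin mg (integrableZ_EFin mOm `|s| iur) _ => // x _.
  rewrite /g; case: ifP => _; first by rewrite normrM.
  by rewrite normr0; apply: mulr_ge0; exact: normr_ge0.
have potw x : Om x -> (potential (G x) (w x) + (g x)%:E <= potential (G x) (u x))%E.
  move=> Ox; rewrite /w /g; case: ifPn => [/set_mem[Ox' _]|_]; last by rewrite adde0.
  by apply: potential_subgradient; exact: Grs.
have mP v : measurable_fun [set: X] v -> measurable_fun Om (fun x => potential (G x) (v x)).
  by move=> mv; apply: measurable_funTS; exact: Gmeas.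
have P0 v x : (0 <= potential (G x) (v x))%E by exact: potential_ge0.
have intP v : measurable_fun [set: X] v -> potential_energy v \is a fin_num ->
    nu.-integrable Om (fun x => potential (G x) (v x)).
  move=> mv jv; apply/integrableP; split; first exact: mP.
  by under eq_integral do rewrite gee0_abs//; move: jv; rewrite fin_numElt => /andP[].
have iPu := intP u mu_ ju.
have iNg := integrable_norm ig.
have jw : potential_energy w \is a fin_num.
  rewrite ge0_fin_numE ?potential_energy_ge0//.
  apply: le_lt_trans (integrable_lty mOm (integrableD mOm iPu iNg)).
  apply: ge0_le_integral => //.
  - exact: (mP w Lw.1).
  - by case/integrableP: (integrableD mOm iPu iNg).
  - move=> x Ox; have := potw x Ox; rewrite -leeBrDr// => /le_trans; apply.
    apply: leeD2l; rewrite -EFinN lee_fin; apply: (le_trans (ler_norm _)).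
    by rewrite normrN.
have iPw := intP w Lw.1 jw.
have Jle : fine (potential_energy w) + \int[nu]_(x in Om) g x <= fine (potential_energy u).
  rewrite -lee_fin EFinD (fineK jw) (fineK ju) -(integral_EFinE mOm ig).
  rewrite /potential_energy -integralD//.
  apply: (le_integral mOm (integrableD mOm iPw ig) iPu) => x Ox.
  by apply: potw; exact: set_mem.
have Lwu := Lp_funB mOm hp Lw Lu.
have ifwu := integrable_mul_Lp_conj mOm hp Lwu mf Lf.2.
pose kk x := f x * (w x - u x) + g x.
have kkE x : kk x = if x \in E then kt x else 0.
  by rewrite /kk /g /w /kt; case: ifP => _; ring.
have kk0 x : 0 <= kk x.
  by rewrite kkE; case: ifPn => // /set_mem[_ /ltW].
have ikk : nu.-integrable Om (EFin \o kk) by exact: integrableD_EFin.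
have Ikk : \int[nu]_(x in Om) kk x <= 0.
  rewrite /kk RintegralD//.
  have := euler_lagrange hs tmin Lw jw; rewrite -/f; lra.
have Ikk0 : (\int[nu]_(x in Om) `|(kk x)%:E| = 0)%E.
  under eq_integral do rewrite gee0_abs ?lee_fin//.
  apply/eqP; rewrite eq_le integral_ge0 ?andbT.
    by rewrite integral_EFinE// lee_fin.
  by move=> x _; rewrite lee_fin.
have mkk : measurable_fun Om (EFin \o kk) by case/integrableP : ikk.
have := (ae_eq_integral_abs nu mOm mkk).1 Ikk0.
apply: filterS => x hx Ox'; have [kz] := hx (OmOm' _ Ox').
rewrite leNgt; apply/negP => neg.
have ktx : 0 < kt x.
  by rewrite /kt -[r - _]opprB mulrN oppr_gt0.
have xE : x \in E by apply/mem_set.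
by move: kz; rewrite kkE xE => kz; rewrite kz ltxx in ktx.
Qed.

End functional.

(** * Integrals of functions equal almost everywhere *)

Section ae_integral.
Context {d} {T : measurableType d} {R : realType}.
Variable mu : {measure set T -> \bar R}.
Local Open Scope ereal_scope.
Import HBNNSimple.

Let ge0_ae_le_integral (f g : T -> \bar R) :
  (forall x, 0 <= f x) -> (forall x, 0 <= g x) ->
  {ae mu, forall x, f x = g x} -> \int[mu]_x f x <= \int[mu]_x g x.
Proof.
move=> f0 g0 [N [mN N0 fgN]]; rewrite ge0_integralTE// ge0_integralTE//.
apply: ge_ereal_sup => _ [h /= hf <-].
pose h' := mul_nnsfun h (indic_nnsfun R (measurableC mN)).
apply: le_ereal_sup_tmp; exists (sintegral mu h').
  exists h' => //= x; rewrite /= mindicE.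
  have [xN|xN] := boolP (x \in ~` N); rewrite ?mulr1 ?mulr0//.
  suff <- : f x = g x by exact: hf.
  by apply: contrapT => fg; move/set_mem: xN; apply; exact: fgN.
rewrite -!integralT_nnsfun le_eqVlt; apply/orP; left; apply/eqP.
apply: ae_eq_integral => //; try exact/measurable_EFinP.
exists N; split => // x /= hx; apply: contrapT => xN; apply: hx => _.
by rewrite /= mindicE mem_set ?mulr1.
Qed.

(** The integral of a nonnegative function is the supremum of the integrals of
    the simple functions below it, and these may be set to 0 on a null set; so
    the integral ignores null sets even for functions that are not measurable.
    The datum phi and the composite of a_p with u are only almost everywhere
    equal to measurable functions. *)
Lemma eq_integral_ae (D : set T) (f g : T -> \bar R) :
  {ae mu, forall x, D x -> f x = g x} ->
  \int[mu]_(x in D) f x = \int[mu]_(x in D) g x.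
Proof.
move=> fg; rewrite [LHS]integral_mkcond [RHS]integral_mkcond.
have fgT : {ae mu, forall x, (f \_ D) x = (g \_ D) x}.
  apply: filterS fg => x fgx; rewrite !patchE; case: ifPn => // /set_mem.
  exact: fgx.
have gfT : {ae mu, forall x, (g \_ D) x = (f \_ D) x} by apply: filterS fgT.
rewrite [LHS]integralE [RHS]integralE; congr (_ - _).
- apply/eqP; rewrite eq_le; apply/andP; split; apply: ge0_ae_le_integral => //.
  + by apply: filterS fgT => x; rewrite !funeposE => ->.
  + by apply: filterS gfT => x; rewrite !funeposE => ->.
- apply/eqP; rewrite eq_le; apply/andP; split; apply: ge0_ae_le_integral => //.
  + by apply: filterS fgT => x; rewrite !funenegE => ->.
  + by apply: filterS gfT => x; rewrite !funenegE => ->.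
Qed.

End ae_integral.

(** * Maximal monotone graphs and their ranges *)

Section maximal_monotone.
Context {R : realType}.
Implicit Types g : R -> set R.

(** The property at (u, v) fails for a point of the graph precisely when that
    point lies in one of two open opposite quadrants with corner (u, v). Such a
    quadrant contains one with a rational corner that still contains the point,
    so it suffices to have one point of the graph in every quadrant with
    rational corner that meets it. *)
Lemma maximal_monotone_test g : maximal_monotone g -> g 0 0 ->
  exists P : nat -> R * R, (forall k, g (P k).1 (P k).2) /\
    forall u v, (forall k, 0 <= (v - (P k).2) * (u - (P k).1)) -> g u v.
Proof.
move=> [mg gmax] g00.
(* The boolean selects the lower right or the upper left quadrant. *)
pose S (i : rat * rat * bool) (Q : R * R) := g Q.1 Q.2 /\
  (if i.2 then ratr i.1.1 < Q.1 /\ Q.2 < ratr i.1.2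
   else Q.1 < ratr i.1.1 /\ ratr i.1.2 < Q.2).
have /choice[P hP] : forall k : nat, exists Q : R * R, g Q.1 Q.2 /\
    forall i, unpickle k = Some i -> (exists Q', S i Q') -> S i Q.
  move=> k; case E : (unpickle k : option (rat * rat * bool)) => [i|]; last first.
    by exists (0, 0); split.
  have [[Q [gQ SQ]]|noQ] := pselect (exists Q, S i Q).
    by exists Q; split => // _ [<-] _; split.
  by exists (0, 0); split => // _ [<-] /noQ.
exists P; split; first by move=> k; case: (hP k).
move=> u v test.
have comp r s : g r s -> 0 <= (v - s) * (u - r).
  move=> grs; rewrite leNgt; apply/negP => neg.
  have [[ur sv]|[ru vs]] : (u < r /\ s < v) \/ (r < u /\ v < s).
    have [ru|ur|E] := ltgtP r u.
    - by right; split => //; rewrite ltNge; apply/negP => h; nra.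
    - by left; split => //; rewrite ltNge; apply/negP => h; nra.
    - by move: neg; rewrite E subrr mulr0 ltxx.
  - have [a /itvP ha] := rat_in_itvoo ur; have [c /itvP hc] := rat_in_itvoo sv.
    have [_ hk] := hP (pickle (a, c, true)).
    have [|_ /= [h1 h2]] := hk (a, c, true) (pickleK _).
      by exists (r, s); split => //=; rewrite ha hc.
    have := test (pickle (a, c, true)).
    have ua : u < ratr a by rewrite ha. have cv : ratr c < v by rewrite hc.
    nra.
  - have [a /itvP ha] := rat_in_itvoo ru; have [c /itvP hc] := rat_in_itvoo vs.
    have [_ hk] := hP (pickle (a, c, false)).
    have [|_ /= [h1 h2]] := hk (a, c, false) (pickleK _).
      by exists (r, s); split => //=; rewrite ha hc.
    have := test (pickle (a, c, false)).
    have ua : ratr a < u by rewrite ha. have cv : v < ratr c by rewrite hc.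
    nra.
apply: (gmax (fun x y => g x y \/ (x = u /\ y = v))); last by right.
- move=> r1 r2 s1 s2 [g1|[-> ->]] [g2|[-> ->]].
  + exact: mg.
  + by have := comp _ _ g1; nra.
  + exact: comp.
  + by rewrite subrr mul0r.
- by move=> r s; left.
Qed.

(** The infima may be -oo, but not +oo since both sets contain 0, so their
    weighted sum is the infimum of the weighted sums. *)
Lemma inf_slopes (S1 S2 : set R) (a b c : R) : 0 < a -> 0 < b -> S1 0 -> S2 0 ->
  (a%:E * ereal_inf [set v%:E | v in S1] +
   b%:E * ereal_inf [set v%:E | v in S2] < c%:E)%E ->
  exists v1 v2, [/\ S1 v1, S2 v2 & a * v1 + b * v2 < c].
Proof.
move=> a0 b0 S10 S20; set I1 := ereal_inf _; set I2 := ereal_inf _ => lt.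
apply: contrapT => no.
have all v1 v2 : S1 v1 -> S2 v2 -> c <= a * v1 + b * v2.
  by move=> h1 h2; rewrite leNgt; apply/negP => h; apply: no; exists v1, v2.
have I1le v2 : S2 v2 -> (((c - b * v2) / a)%:E <= I1)%E.
  move=> h2; apply: le_ereal_inf_tmp => _ [v1 h1 <-]; rewrite lee_fin.
  by rewrite ler_pdivrMr//; have := all _ _ h1 h2; lra.
have I10 : (I1 <= 0)%E by apply: ereal_inf_lbound; exists 0.
have I1f : I1 \is a fin_num.
  rewrite fin_numElt (lt_le_trans _ (I1le 0 S20)) ?ltNyr//=.
  by rewrite (le_lt_trans I10)// ltry.
have I2ge : (((c - a * fine I1) / b)%:E <= I2)%E.
  apply: le_ereal_inf_tmp => _ [v2 h2 <-]; rewrite lee_fin.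
  have := I1le _ h2; rewrite -(fineK I1f) lee_fin ler_pdivrMr// ler_pdivrMr//=; lra.
have I20 : (I2 <= 0)%E by apply: ereal_inf_lbound; exists 0.
have I2f : I2 \is a fin_num.
  rewrite fin_numElt (lt_le_trans _ I2ge) ?ltNyr//=.
  by rewrite (le_lt_trans I20)// ltry.
move: lt I2ge; rewrite -(fineK I1f) -(fineK I2f) -!EFinM -EFinD lte_fin lee_fin.
by rewrite ler_pdivrMr//=; lra.
Qed.

Lemma sup_slopes (S1 S2 : set R) (a b c : R) : 0 < a -> 0 < b -> S1 0 -> S2 0 ->
  (c%:E < a%:E * ereal_sup [set v%:E | v in S1] +
   b%:E * ereal_sup [set v%:E | v in S2])%E ->
  exists v1 v2, [/\ S1 v1, S2 v2 & c < a * v1 + b * v2].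
Proof.
move=> a0 b0 S10 S20 h.
have opp (S : set R) : ereal_sup [set v%:E | v in S] =
    (- ereal_inf [set v%:E | v in [set (- v)%R | v in S]])%E.
  rewrite ereal_supEN; congr (- ereal_inf _)%E; apply/seteqP; split.
    by move=> _ [_ [v Sv <-] <-]; exists (- v) => //; exists v.
  by move=> _ [_ [v Sv <-] <-]; exists v%:E => //; exists v.
have key (x y : \bar R) : (x <= 0)%E -> (y <= 0)%E ->
    (c%:E < a%:E * - x + b%:E * - y)%E -> (a%:E * x + b%:E * y < (- c)%:E)%E.
  move=> x0 y0; rewrite !muleN -oppeD; first by rewrite EFinN lteNr.
  rewrite -adde_defNN; apply: ge0_adde_def; rewrite inE /= oppe_ge0.
    by apply: mule_ge0_le0 => //; rewrite lee_fin ltW.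
  by apply: mule_ge0_le0 => //; rewrite lee_fin ltW.
have [|||_ [_ [[v1 h1 <-] [v2 h2 <-] lt]]] :=
    @inf_slopes [set - v | v in S1] [set - v | v in S2] a b (- c) a0 b0.
- by exists 0; rewrite ?oppr0.
- by exists 0; rewrite ?oppr0.
- have neg (S : set R) : S 0 -> (ereal_inf [set v%:E | v in [set (- v)%R | v in S]] <= 0)%E.
    by move=> S0; apply: ereal_inf_lbound; exists 0 => //; exists 0; rewrite ?oppr0.
  by apply: key; [exact: neg|exact: neg|rewrite -!opp].
by exists v1, v2; split => //; lra.
Qed.

End maximal_monotone.

(** * A regular version of the flux *)

Section regular_version.
Context {d} {R : realType} {X : measurableType d}.
Variables (nu : {measure set X -> \bar R}) (m : R.-pker X ~> X).
Hypothesis hrev : reversible nu m.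
Variables (p c C : R) (a : X -> X -> R -> R).
Hypotheses (hp : 1 < p) (c0 : 0 < c) (C0 : 0 <= C).

(** Coercivity forces the sign of f on both sides of 0. *)
Let coercive_at0 (f : R -> R) : continuous f ->
  (forall r, c * `|r| `^ p <= f r * r) -> f 0 = 0.
Proof.
move=> cf hf.
have pos r : 0 < r -> 0 <= f r.
  move=> r0; rewrite -(pmulr_lge0 _ r0); apply: le_trans (hf r).
  by rewrite mulr_ge0 ?powR_ge0// ltW.
have neg r : r < 0 -> f r <= 0.
  move=> r0; rewrite -(nmulr_lge0 _ r0); apply: le_trans (hf r).
  by rewrite mulr_ge0 ?powR_ge0// ltW.
have h0 : (harmonic n : R) @[n --> \oo] --> (0 : R) by exact: cvg_harmonic.
have hN0 : (- harmonic n : R) @[n --> \oo] --> (0 : R).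
  by rewrite -oppr0; apply: cvgN.
apply/eqP; rewrite eq_le; apply/andP; split.
  have h : f (- harmonic n) @[n --> \oo] --> f 0 by exact: (cvg_comp _ _ hN0 (@cf 0)).
  apply: (cvgr_to_le h); apply: nearW => n /=.
  by apply: neg; rewrite oppr_lt0 /harmonic/= invr_gt0.
have h : f (harmonic n) @[n --> \oo] --> f 0 by exact: (cvg_comp _ _ h0 (@cf 0)).
apply: (cvgr_to_ge h); apply: nearW => n /=.
by apply: pos; rewrite /harmonic/= invr_gt0.
Qed.

(** The flux is set to 0 on a null set outside of which all the properties hold.
    Antisymmetry relates the values at (x, y) and (y, x), so the null set is
    made symmetric, which by reversibility leaves it null. *)
Lemma regular_flux_exists : leray_lions nu m p c C a ->
  exists b N, regular_flux nu m p c C b N /\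
    forall z, ~ N z -> forall r, b z r = a z.1 z.2 r.
Proof.
case=> am ac aa amono ag aco.
have [N1 [mN1 N10 hN1]] : {ae walk_prod nu m, forall z,
    [/\ continuous (a z.1 z.2),
     forall r : R, a z.1 z.2 r = - a z.2 z.1 (- r),
     forall r s : R, r != s -> 0 < (a z.1 z.2 r - a z.1 z.2 s) * (r - s),
     forall r : R, `|a z.1 z.2 r| <= C * (1 + `|r| `^ (p - 1)) &
     forall r : R, c * `|r| `^ p <= a z.1 z.2 r * r]}.
  apply: filterS2 (filterI ac (filterI aa amono)) (filterI ag aco) => z.
  by move=> [? [? ?]] [? ?]; split.
pose N := N1 `|` @flip X @^-1` N1.
have mF : measurable (@flip X @^-1` N1).
  by rewrite -[X in measurable X]setTI; exact: measurable_flip.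
have mN : measurable N by exact: measurableU.
have N0 : walk_prod nu m N = 0%E.
  rewrite null_set_setU//; rewrite -[RHS]N10; exact: walk_prod_flip.
have good z : ~ N z ->
    [/\ continuous (a z.1 z.2),
     forall r : R, a z.1 z.2 r = - a z.2 z.1 (- r),
     forall r s : R, r != s -> 0 < (a z.1 z.2 r - a z.1 z.2 s) * (r - s),
     forall r : R, `|a z.1 z.2 r| <= C * (1 + `|r| `^ (p - 1)) &
     forall r : R, c * `|r| `^ p <= a z.1 z.2 r * r].
  by move=> Nz; apply: contrapT => bad; apply: Nz; left; exact: hN1.
pose b z r := if z \in N then 0 else a z.1 z.2 r.
have bN z r : N z -> b z r = 0 by move=> Nz; rewrite /b mem_set.
have bE z r : ~ N z -> b z r = a z.1 z.2 r by move=> Nz; rewrite /b memNset.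
exists b, N; split; last by move=> z Nz r; exact: bE.
split => //.
- move=> r; apply: measurable_fun_ifT => //; exact: measurable_fun_in.
- move=> z; have [Nz|Nz] := pselect (N z).
    by rewrite (_ : b z = cst 0); [exact: cst_continuous|apply/funext => r; exact: bN].
  have [ca _ _ _ _] := good z Nz.
  by rewrite (_ : b z = a z.1 z.2)//; apply/funext => r; exact: bE.
- move=> z r s; have [Nz|Nz] := pselect (N z).
    by rewrite !bN// subrr mul0r.
  have [_ _ ma _ _] := good z Nz; rewrite !bE//.
  by have [->|rs] := eqVneq r s; [rewrite !subrr mulr0|exact/ltW/ma].
- move=> z; have [Nz|Nz] := pselect (N z); first exact: bN.
  by have [ca _ _ _ coa] := good z Nz; rewrite bE//; exact: coercive_at0.
- move=> z r; have [Nz|Nz] := pselect (N z).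
    by rewrite bN// normr0 mulr_ge0// addr_ge0// powR_ge0.
  by have [_ _ _ ga _] := good z Nz; rewrite bE.
- by move=> z Nz r; have [_ _ _ _ coa] := good z Nz; rewrite bE.
- move=> z r; have NF : N (flip z) <-> N z.
    by case: z => x y; rewrite /N /=; tauto.
  have [Nz|Nz] := pselect (N z).
    by rewrite bN// bN ?oppr0//; exact/NF.
  have NFz : ~ N (flip z) by move/NF.
  by have [_ aza _ _ _] := good z Nz; rewrite bE// bE// aza.
Qed.

End regular_version.

(** * The graphs on the two parts of the domain *)

Section two_graphs.
Context {d} {R : realType} {X : measurableType d}.
Variables (nu : {measure set X -> \bar R}) (Om1 Om2 : set X).
Hypotheses (mOm1 : measurable Om1) (mOm2 : measurable Om2).
Hypothesis hdisj : Om1 `&` Om2 = set0.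
Hypothesis hfin : (nu (Om1 `|` Om2) < +oo)%E.
Variables gamma beta : R -> set R.
Hypotheses (mgamma : monotone_graph gamma) (mbeta : monotone_graph beta).
Hypotheses (hgamma0 : gamma 0 0) (hbeta0 : beta 0 0).

Definition graph_on (x : X) : R -> set R := if x \in Om1 then gamma else beta.

Lemma graph_on1 x : Om1 x -> graph_on x = gamma.
Proof. by move=> Ox; rewrite /graph_on mem_set. Qed.

Lemma graph_on2 x : Om2 x -> graph_on x = beta.
Proof.
move=> O2; rewrite /graph_on memNset// => O1.
by have : (Om1 `&` Om2) x by []; rewrite hdisj.
Qed.

Lemma graph_on_monotone x : monotone_graph (graph_on x).
Proof. by rewrite /graph_on; case: ifP. Qed.

Lemma graph_on0 x : graph_on x 0 0.
Proof. by rewrite /graph_on; case: ifP. Qed.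

Lemma measurable_potential_graph_on (u : X -> R) : measurable_fun [set: X] u ->
  measurable_fun [set: X] (fun x => potential (graph_on x) (u x)).
Proof.
move=> mu; rewrite (_ : (fun x => _) = (fun x => if x \in Om1
    then potential gamma (u x) else potential beta (u x))); last first.
  by apply/funext => x; rewrite /graph_on; case: ifP.
apply: measurable_fun_ifT; first exact: measurable_fun_in.
- by apply: measurableT_comp => //; exact: measurable_potential.
- by apply: measurableT_comp => //; exact: measurable_potential.
Qed.

Let hfin1 : (nu Om1 < +oo)%E.
Proof.
apply: le_lt_trans hfin; apply: le_measure; rewrite ?inE//; exact: measurableU.
Qed.

Let hfin2 : (nu Om2 < +oo)%E.
Proof.
apply: le_lt_trans hfin; apply: le_measure; rewrite ?inE//; exact: measurableU.
Qed.

(** A slope v1 attained at r1 gives the tangent v1 (r - r1) of the potential;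
    taking one slope for each graph, with V constant on each part of the domain,
    the integral of V is the weighted sum that enters the range constants. *)
Lemma affine_minorant_of_slopes v1 v2 : Ran gamma v1 -> Ran beta v2 ->
  exists V k, affine_minorant graph_on V k /\
    \int[nu]_(x in Om1 `|` Om2) V x = fine (nu Om1) * v1 + fine (nu Om2) * v2.
Proof.
move=> [r1 _ g1] [r2 _ g2].
pose V x := if x \in Om1 then v1 else v2.
have mV : measurable_fun [set: X] V.
  by apply: measurable_fun_ifT => //; exact: measurable_fun_in.
exists V, (`|v1 * r1| + `|v2 * r2|); split.
  have minor (g : R -> set R) (r v k s : R) : monotone_graph g -> g 0 0 -> g r v -> `|v * r| <= k ->
      ((v * s - k)%:E <= potential g s)%E.
    move=> mg g00 gv vk; apply: le_trans (potential_subgradient s gv).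
    apply: (@le_trans _ _ (v * (s - r))%:E).
      by rewrite lee_fin; have := ler_norm (v * r); lra.
    by rewrite leeDr// potential_ge0.
  split => //.
    exists (`|v1| + `|v2|) => x; rewrite /V; case: ifP => _.
      by rewrite lerDl.
    by rewrite lerDr.
  move=> x s; rewrite /V /graph_on; case: ifP => _.
    by apply: (minor _ _ _ _ s mgamma hgamma0 g1); rewrite lerDl.
  by apply: (minor _ _ _ _ s mbeta hbeta0 g2); rewrite lerDr.
have mOm : measurable (Om1 `|` Om2) by exact: measurableU.
have iV : nu.-integrable (Om1 `|` Om2) (EFin \o V).
  apply: (le_integrable_EFin mOm mV (integrable_cst_EFin mOm hfin (`|v1| + `|v2|))).
  by move=> x _; rewrite /V; case: ifP => _; rewrite ?lerDl ?lerDr.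
rewrite Rintegral_setU//; last by rewrite disj_set2E hdisj.
have -> : \int[nu]_(x in Om1) V x = \int[nu]_(x in Om1) v1.
  by apply: eq_Rintegral => x xOm1; rewrite /V xOm1.
have -> : \int[nu]_(x in Om2) V x = \int[nu]_(x in Om2) v2.
  apply: eq_Rintegral => x /set_mem O2; rewrite /V memNset// => O1.
  by have : (Om1 `&` Om2) x by []; rewrite hdisj.
by rewrite !Rintegral_cst// ![_ * fine _]mulrC.
Qed.

Hypotheses (hOm1 : (0 < nu Om1)%E) (hOm2 : (0 < nu Om2)%E).

Let n1E : nu Om1 = (fine (nu Om1))%:E. Proof. by rewrite fineK// ge0_fin_numE. Qed.
Let n2E : nu Om2 = (fine (nu Om2))%:E. Proof. by rewrite fineK// ge0_fin_numE. Qed.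
Let n10 : 0 < fine (nu Om1). Proof. by rewrite fine_gt0// hOm1. Qed.
Let n20 : 0 < fine (nu Om2). Proof. by rewrite fine_gt0// hOm2. Qed.

Lemma affine_minorant_below c : (R_minus nu Om1 Om2 gamma beta < c%:E)%E ->
  exists V k, affine_minorant graph_on V k /\
    \int[nu]_(x in Om1 `|` Om2) V x < c.
Proof.
rewrite /R_minus n1E n2E => h.
have [||v1 [v2 [h1 h2 lt]]] := @inf_slopes _ (Ran gamma) (Ran beta) _ _ c n10 n20 _ _ h.
- by exists 0.
- by exists 0.
have [V [k [hV IV]]] := affine_minorant_of_slopes h1 h2.
by exists V, k; split => //; rewrite IV.
Qed.

Lemma affine_minorant_above c : (c%:E < R_plus nu Om1 Om2 gamma beta)%E ->
  exists V k, affine_minorant graph_on V k /\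
    c < \int[nu]_(x in Om1 `|` Om2) V x.
Proof.
rewrite /R_plus n1E n2E => h.
have [||v1 [v2 [h1 h2 lt]]] := @sup_slopes _ (Ran gamma) (Ran beta) _ _ c n10 n20 _ _ h.
- by exists 0.
- by exists 0.
have [V [k [hV IV]]] := affine_minorant_of_slopes h1 h2.
by exists V, k; split => //; rewrite IV.
Qed.

End two_graphs.

(** * Existence of solutions *)

Theorem theorem2p7 (R : realType) (d : measure_display)
  (X : completeMetricMeasurableType d R) (hX : polish_borel X)
  (m : R.-pker X ~> X) (hm : finite_first_moment m)
  (nu : {sigma_finite_measure set X -> \bar R}) (hrev : reversible nu m)
  (p : R) (hp : 1 < p)
  (cp Cp : R) (hcp : 0 < cp) (hCp : 0 < Cp)
  (a : X -> X -> R -> R) (ha : leray_lions nu m p cp Cp a)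
  (Om1 Om2 : set X)
  (mOm1 : measurable Om1) (mOm2 : measurable Om2)
  (hOm1 : (0 < nu Om1)%E) (hOm2 : (0 < nu Om2)%E)
  (hdisj : Om1 `&` Om2 = set0)
  (hconn : m_connected nu m (Om1 `|` Om2))
  (hfin : (nu (Om1 `|` Om2) < +oo)%E)
  (hsing : nu.-negligible
     [set x | (Om1 `|` Om2) x /\ singular_on (Om1 `|` Om2) (m x) nu])
  (gamma beta : R -> set R)
  (hgamma : maximal_monotone gamma) (hbeta : maximal_monotone beta)
  (hgamma0 : gamma 0 0) (hbeta0 : beta 0 0)
  (hR : (R_minus nu Om1 Om2 gamma beta < R_plus nu Om1 Om2 gamma beta)%E)
  (hpoinc : poincare nu m p (Om1 `|` Om2))
  (phi : X -> R)
  (hphi : in_Lp nu (p / (p - 1)) (Om1 `|` Om2) phi)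
  (hphi_lo : (R_minus nu Om1 Om2 gamma beta
              < \int[nu]_(x in Om1 `|` Om2) (phi x)%:E)%E)
  (hphi_hi : (\int[nu]_(x in Om1 `|` Om2) (phi x)%:E
              < R_plus nu Om1 Om2 gamma beta)%E) :
  exists u v : X -> R, GP_solution nu m Om1 Om2 gamma beta p a phi u v.
Proof.
have mOm : measurable (Om1 `|` Om2) by exact: measurableU.
have nuOm0 : (0 < nu (Om1 `|` Om2))%E.
  apply: (lt_le_trans hOm1); apply: le_measure; rewrite ?inE//.
have q0 : 0 < p / (p - 1) by exact: conj_exp_gt0.
(* A measurable representative of the datum. *)
have [phi0 hphi0 phiE] := in_LpE q0 hphi.
have [b [N [hb bE]]] := regular_flux_exists hrev hcp (ltW hCp) ha.
have q1 : 1 < p / (p - 1) by rewrite ltr_pdivlMr ?subr_gt0// mul1r ltrBlDr ltrDl.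
have iphi0 := Lp_fun_integrable mOm q1 hfin hphi0.
have IphiE : (\int[nu]_(x in Om1 `|` Om2) (phi x)%:E =
    (\int[nu]_(x in Om1 `|` Om2) phi0 x)%:E)%E.
  rewrite -(integral_EFinE mOm iphi0); apply: eq_integral_ae.
  by apply: filterS phiE => x + Ox => /(_ Ox) ->.
rewrite IphiE in hphi_lo hphi_hi.
have mgamma := hgamma.1; have mbeta := hbeta.1.
have [V1 [k1 [hV1 V1phi]]] := affine_minorant_above mOm1 mOm2 hdisj hfin
  mgamma mbeta hgamma0 hbeta0 hOm1 hOm2 hphi_hi.
have [V2 [k2 [hV2 V2phi]]] := affine_minorant_below mOm1 mOm2 hdisj hfin
  mgamma mbeta hgamma0 hbeta0 hOm1 hOm2 hphi_lo.
have hGm x : monotone_graph (graph_on Om1 gamma beta x) by exact: graph_on_monotone.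
have hG0 x : graph_on Om1 gamma beta x 0 0 by exact: graph_on0.
have hGmeas (w : X -> R) : measurable_fun [set: X] w ->
    measurable_fun [set: X] (fun x => potential (graph_on Om1 gamma beta x) (w x)).
  exact: measurable_potential_graph_on.
have [t [u [hu tmin]]] := sublevel_min hrev mOm hfin nuOm0 hp hpoinc hb hGm hG0
  hGmeas hphi0 hV1 hV2 V1phi V2phi.
have [Lu _ _] := hu; have [mu _] := Lu.
have Lnf := Lp_fun_netflux hrev mOm hfin hp hb Lu.
have Lv := Lp_funD mOm q1 hphi0 Lnf.
pose v x := phi0 x + netflux m (Om1 `|` Om2) b u x.
have graphs (Om' : set X) (g : R -> set R) : measurable Om' ->
    Om' `<=` Om1 `|` Om2 -> maximal_monotone g -> g 0 0 ->
    (forall x, Om' x -> graph_on Om1 gamma beta x = g) ->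
    {ae nu, forall x, Om' x -> g (u x) (v x)}.
  move=> mOm' OmOm' gmax g00 gE.
  have [P [gP Ptest]] := maximal_monotone_test gmax g00.
  have : {ae nu, forall x, forall k, Om' x -> 0 <= (v x - (P k).2) * (u x - (P k).1)}.
    apply/ae_foralln => k.
    apply: (minimiser_monotone_test hrev mOm hfin hp hb hGmeas hphi0 hu tmin) => //.
    by move=> x Ox; rewrite gE.
  by apply: filterS => x hx Ox; apply: Ptest => k; exact: hx.
exists u, v; split.
- by apply: (in_LpI mOm (lt_trans ltr01 hp) mu Lu.2); exact: nearW.
- by apply: (in_LpI mOm q0 Lv.1 Lv.2); exact: nearW.
- apply: graphs => //.
  by move=> x Ox; exact: graph_on1.
- apply: graphs => //.
  by move=> x Ox; exact: graph_on2 hdisj _ _ _ Ox.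
- apply: (in_LpI (measurableX mOm mOm) q0 (measurable_flux hb mu)).
    exact: (flux_conj_integrable hrev mOm hfin hp hb Lu).
  exists N; split; [exact: rf_measN hb|exact: rf_null hb|].
  by move=> z /=; apply: contra_notP => Nz _; rewrite /flux bE.
- have := walk_prod_section_null (rf_measN hb) (rf_null hb).
  move=> /(filterS3 _ _ phiE (netfluxE hrev mOm hfin hp hb Lu)); apply.
  move=> x phix + mN Ox => /(_ Ox) nfx.
  rewrite (_ : (\int[m x]_(y in _) _)%E = (netflux m (Om1 `|` Om2) b u x)%:E).
    by rewrite -EFinB /v addrK phix.
  rewrite -nfx; apply: eq_integral_ae; exists (xsection N x); split => //.
    exact: measurable_xsection (rf_measN hb).
  move=> y /=; apply: contra_notP => Ny _; rewrite /flux bE// => Nxy; apply: Ny.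
  by rewrite /xsection /= inE.
Qed.
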